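(* There exist constants $c_1,c_2>0$ such that for all nonzero real-valued $f\in H^1[-1,1]$ $$\int_{-1}^{1}|\widehat{f}(\xi)|^2\,d\xi\;\geq\; c_1\left(c_2\frac{\|f_x\|_{L^2[-1,1]}}{\|f\|_{L^2[-1,1]}}\right)^{-c_2\frac{\|f_x\|_{L^2[-1,1]}}{\|f\|_{L^2[-1,1]}}}\int_{-1}^{1}|f(x)|^2\,dx.$$
   Context: For $f\in L^2[-1,1]$, extended by $0$ outside $[-1,1]$, the Fourier transform is $\widehat{f}(\xi)=\int_{-1}^{1}f(x)e^{i\xi x}\,dx$. $H^1[-1,1]$ is the Sobolev space of $L^2[-1,1]$ functions with weak derivative in $L^2[-1,1]$, and $f_x$ denotes the (weak) derivative of $f$ on $(-1,1)$ (no boundary condition at $\pm1$ is imposed). The convention $0^0=1$ is used when $f_x=0$. *)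

(* Defs.v *)
From HB Require Import structures.
From mathcomp Require Import all_boot all_order all_algebra.
From mathcomp Require Import complex.
From mathcomp Require Import all_classical all_reals all_analysis.

Set Implicit Arguments.
Unset Strict Implicit.
Unset Printing Implicit Defensive.

Import Order.TTheory GRing.Theory Num.Theory.
Import numFieldNormedType.Exports.

Local Open Scope classical_set_scope.
Local Open Scope ring_scope.

Section Defs.
Context {R : realType}.

Definition leb : {measure set (measurableTypeR R) -> \bar R} :=
  @lebesgue_measure R.

Definition I11 : set R := `[-1, 1].

(* Elements of L^2[-1, 1] are represented by functions f : R -> R, of which
   only the values on [-1, 1] matter: [f \_ I11] is f on [-1, 1] and 0
   elsewhere. *)
Definition L2 (f : R -> R) : Prop := (f \_ I11) \in Lfun leb 2%:E.

Definition L2norm (f : R -> R) : R :=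
  fine (Lnorm leb 2%:E (EFin \o (f \_ I11))).

(* C_c^oo(-1, 1): the support is closed and contained in a bounded interval,
   hence automatically compact. *)
Definition test_function (phi : R -> R) : Prop :=
  (forall n x, derivable (phi^`(n))%classic x 1) /\
  closure [set x | phi x != 0] `<=` `]-1, 1[.

Definition weak_derivative (f g : R -> R) : Prop :=
  forall phi, test_function phi ->
    \int[leb]_(x in I11) (f x * (phi^`())%classic x) =
    - \int[leb]_(x in I11) (g x * phi x).

Definition H1_derivative (f fx : R -> R) : Prop :=
  L2 fx /\ weak_derivative f fx.

Definition H1 (f : R -> R) : Prop :=
  L2 f /\ exists fx, H1_derivative f fx.

Definition expi (t : R) : R[i] := Complex (cos t) (sin t).

Definition cintegral (D : set R) (h : R -> R[i]) : R[i] :=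
  Complex (\int[leb]_(x in D) complex.Re (h x))
          (\int[leb]_(x in D) complex.Im (h x)).

Definition fourier (f : R -> R) (xi : R) : R[i] :=
  cintegral I11 (fun x => real_complex R (f x) * expi (xi * x)).

(* The modulus with values in R; the norm of R[i] takes its values in R[i]. *)
Definition cmod (z : R[i]) : R := ComplexField.Normc.normc z.

End Defs.

(* Main.v *)
Require Import Defs.
From mathcomp Require Import all_boot all_order all_algebra.
From mathcomp Require Import complex.
From mathcomp Require Import all_classical all_reals all_analysis.
From mathcomp Require Import measurable_realfun ring lra zify.

(** The idea is to test f against itself with a kernel of low frequency.

    For a combination K of cosines, the quadratic form given by the double integral
    of f(x) f(y) K(x - y) is the same combination of the values of |fourier f|^2 at
    the frequencies of K.  If these are at most 1/2, averaging over shifts of the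
    frequencies by at most 1/2 bounds it by M times the integral of |fourier f|^2
    over [-1, 1], where M is the sum of the absolute values of the coefficients
    ([quadratic_form_cosine_sum], [energy_le_fourier_power]).

    Conversely, if K is nonnegative on [-2, 2] and concentrated at a scale 1/N at
    which f hardly varies, the form is comparable to the squared norm of f.
    Indeed f(x) f(y) >= f(x)^2 / 2 - (f(x) - f(y))^2 / 2; the first term
    contributes the mass of K times the squared norm of f, and the second one is
    at most a multiple of 1/N^2 times the mass of K times the squared norm of f_x
    ([kernel_mass], [kernel_increment_le], [quadratic_form_energy]).  So it
    suffices that N be a large multiple of |f_x| / |f|.

    A function of low frequency cannot be concentrated at scale 1/N on the
    whole line, but it can be on [-2, 2], if one accepts huge coefficients.
    Such a superoscillating kernel is obtained by plugging 1 - B + B cos (w t), with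
    w ~ 1/N and B ~ N^2, in the sixth power of a Dirichlet kernel of degree N
    written as a polynomial in the cosine.  The substitution magnifies t near 0 and
    costs M <= (30 N)^(12 N) ([concentrated_kernel]).  With N proportional to
    |f_x| / |f|, the cost M is the power in the statement, up to the choice of the
    constants ([kernel_cost_balance]).

    The only fact about weak derivatives that enters is the bound of |f(x) - f(y)|
    by the integral of |f_x| near the segment from x to y, for almost all x and y
    ([weak_derivative_increment]).  It is obtained at Lebesgue points of f by testing
    with smoothed indicators of intervals, built from exp (-1/x). *)

Set Implicit Arguments.
Unset Strict Implicit.
Unset Printing Implicit Defensive.

Import Order.TTheory GRing.Theory Num.Theory.
Import numFieldNormedType.Exports.

Local Open Scope classical_set_scope.
Local Open Scope ring_scope.

(** * Cosine sums and Chebyshev polynomials *)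

Section CosineSums.
Context {R : realType}.
Implicit Types (W M : R) (Q : R -> R).

(** [W] bounds the frequencies of a finite cosine sum and [M] the l^1 norm of
its coefficients.  This is exactly the information needed later: frequencies
must stay in the observed band, and [M] is the price paid for the kernel. *)
Definition cosine_sum (W M : R) (Q : R -> R) : Prop :=
  exists s : seq (R * R),
    [/\ forall t, Q t = \sum_(p <- s) p.1 * cos (p.2 * t),
        forall p, p \in s -> `|p.2| <= W &
        \sum_(p <- s) `|p.1| <= M].

Lemma cosine_sumW W M W' M' Q : W <= W' -> M <= M' ->
  cosine_sum W M Q -> cosine_sum W' M' Q.
Proof.
move=> WW MM [s [sQ sW sM]]; exists s; split => // [p ps|].
  exact: le_trans (sW _ ps) WW.
exact: le_trans sM MM.
Qed.

Lemma cosine_sum_ge0 W M Q : cosine_sum W M Q -> 0 <= M.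
Proof. by move=> [s [_ _]]; apply: le_trans; apply: sumr_ge0. Qed.

Lemma cosine_sum_cst a : cosine_sum 0 `|a| (cst a).
Proof.
exists [:: (a, 0)]; split.
- by move=> t; rewrite big_seq1/= mul0r cos0 mulr1.
- by move=> p; rewrite inE => /eqP ->; rewrite normr0.
- by rewrite big_seq1.
Qed.

Lemma cosine_sum_cos w : cosine_sum `|w| 1 (fun t => cos (w * t)).
Proof.
exists [:: (1, w)]; split.
- by move=> t; rewrite big_seq1/= mul1r.
- by move=> p; rewrite inE => /eqP ->.
- by rewrite big_seq1/= normr1.
Qed.

Lemma cosine_sumD W M1 M2 Q1 Q2 : cosine_sum W M1 Q1 -> cosine_sum W M2 Q2 ->
  cosine_sum W (M1 + M2) (fun t => Q1 t + Q2 t).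
Proof.
move=> [s1 [Q1E W1 sM1]] [s2 [Q2E W2 sM2]]; exists (s1 ++ s2); split.
- by move=> t; rewrite big_cat/= -Q1E -Q2E.
- by move=> p; rewrite mem_cat => /orP[/W1|/W2].
- by rewrite big_cat/= lerD.
Qed.

(** The addition formula 2 cos a cos b = cos (a + b) + cos (a - b) makes the
class an algebra in which frequencies add and costs multiply. *)
Lemma cosine_sumM W1 W2 M1 M2 Q1 Q2 :
  cosine_sum W1 M1 Q1 -> cosine_sum W2 M2 Q2 ->
  cosine_sum (W1 + W2) (M1 * M2) (fun t => Q1 t * Q2 t).
Proof.
move=> /[dup]/cosine_sum_ge0 M10 [s1 [Q1E sW1 sM1]] [s2 [Q2E sW2 sM2]].
(* Each pair of frequencies contributes their sum and their difference. *)
exists (flatten [seq [:: (p.1 * q.1 / 2, p.2 + q.2); (p.1 * q.1 / 2, p.2 - q.2)]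
                | p <- s1, q <- s2]); split.
- move=> t; rewrite Q1E Q2E big_flatten/= big_allpairs_dep/= mulr_suml.
  apply: eq_bigr => p _; rewrite mulr_sumr; apply: eq_bigr => q _.
  by rewrite big_cons big_seq1/= mulrDl mulrBl cosD cosB; field.
- move=> r /flattenP[l /allpairsPdep[p [q [ps qs ->]]]].
  rewrite !inE => /orP[|] /eqP -> /=.
    rewrite (le_trans (ler_normD _ _))//; apply: lerD; [exact: sW1|exact: sW2].
  rewrite (le_trans (ler_normB _ _))//; apply: lerD; [exact: sW1|exact: sW2].
- rewrite big_flatten/= big_allpairs_dep/=.
  apply: (@le_trans _ _ ((\sum_(p <- s1) `|p.1|) * (\sum_(p <- s2) `|p.1|))).
    rewrite mulr_suml ler_sum// => p _; rewrite mulr_sumr ler_sum// => q _.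
    by rewrite big_cons big_seq1/= !normrM normfV (ger0_norm (ler0n _ 2)) -splitr.
  by apply: ler_pM => //; exact: sumr_ge0.
Qed.

Lemma cosine_sumX W M Q n : cosine_sum W M Q ->
  cosine_sum (W * n%:R) (M ^+ n) (fun t => Q t ^+ n).
Proof.
move=> QQ; elim: n => [|n IH].
  rewrite mulr0 expr0 (_ : (fun _ => _) = cst 1).
    by rewrite -[X in cosine_sum _ X](@normr1 R); exact: cosine_sum_cst.
  by apply/funext => t; rewrite expr0.
rewrite exprS -natr1 mulrDr mulr1 addrC.
rewrite (_ : (fun _ => _) = (fun t => Q t * Q t ^+ n)); first exact: cosine_sumM.
by apply/funext => t; rewrite exprS.
Qed.

End CosineSums.

Section Chebyshev.
Context {R : realType}.
Implicit Types (c : R) (n : nat).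

(** Chebyshev polynomials of the first kind, cheb (cos t) n = cos (n t).  Working
with the recursion avoids the angle t altogether. *)
Fixpoint cheb (c : R) (n : nat) : R :=
  match n with
  | 0 => 1
  | n1.+1 => match n1 with 0 => c | n2.+1 => 2 * c * cheb c n1 - cheb c n2 end
  end.

Lemma chebSS c n : cheb c n.+2 = 2 * c * cheb c n.+1 - cheb c n.
Proof. by []. Qed.

(** Dirichlet kernel: at c = cos t this is sin ((n + 1/2) t) / sin (t / 2). *)
Definition dirichlet (c : R) (n : nat) : R := 1 + 2 * \sum_(i < n) cheb c i.+1.

Lemma dirichletS c n : dirichlet c n.+1 = dirichlet c n + 2 * cheb c n.+1.
Proof. by rewrite /dirichlet big_ord_recr/= mulrDr addrA. Qed.

(** In terms of the angle, this is the law of cosines satisfied by cos (n t) and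
cos ((n + 1) t); it is conserved by the recursion. *)
Lemma cheb_invariant c n :
  cheb c n ^+ 2 + cheb c n.+1 ^+ 2 - 2 * c * cheb c n * cheb c n.+1 = 1 - c ^+ 2.
Proof.
elim: n => [|n IH]; first by rewrite /=; ring.
by rewrite chebSS -[RHS]IH; ring.
Qed.

Lemma dirichlet_telescope c n :
  (1 - c) * dirichlet c n = cheb c n - cheb c n.+1.
Proof.
elim: n => [|n IH]; first by rewrite /dirichlet big_ord0 /=; ring.
by rewrite dirichletS mulrDr IH chebSS; ring.
Qed.

Lemma cheb_le1 c n : 0 <= c <= 1 -> `|cheb c n| <= 1.
Proof.
move=> /andP[c0]; rewrite le_eqVlt => /predU1P[->|c1].
  suff H : cheb (1 : R) n = 1 /\ cheb (1 : R) n.+1 = 1 by rewrite H.1 normr1.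
  elim: n => [//|n [IH1 IH2]]; split => //.
  by rewrite chebSS IH1 IH2; ring.
have := cheb_invariant c n; set a := cheb c n; set b := cheb c n.+1 => ab.
have H : (1 - c ^+ 2) * a ^+ 2 <= (1 - c ^+ 2) * 1.
  by have := sqr_ge0 (b - c * a); nra.
have c21 : 0 < 1 - c ^+ 2 by nra.
rewrite ler_pM2l// in H.
by rewrite -(@ler_pXn2r _ 2) ?nnegrE// expr1n real_normK ?num_real.
Qed.

(** Algebraic form of 1 - cos (n t) <= n^2 (1 - cos t): the increments of
1 - cheb c n grow by at most 2 (1 - c) at each step. *)
Lemma cheb_ge c n : 0 <= c <= 1 -> 1 - n%:R ^+ 2 * (1 - c) <= cheb c n.
Proof.
move=> c01.
have H1 m : cheb c m - cheb c m.+1 <= (2 * m%:R + 1) * (1 - c).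
  elim: m => [|m IH]; first by rewrite /=; lra.
  have := cheb_le1 m.+1 c01; rewrite ler_norml => /andP[_ C1].
  rewrite chebSS -natr1.
  by move: c01 => /andP[? ?]; nra.
elim: n => [|n IH]; first by rewrite /=; lra.
by have := H1 n; rewrite -natr1; nra.
Qed.

Lemma dirichlet_ge c n : 0 <= c <= 1 -> n%:R ^+ 2 * (1 - c) <= 2^-1 ->
  n%:R <= dirichlet c n.
Proof.
move=> c01 nc.
have H : \sum_(i < n) (2^-1 : R) <= \sum_(i < n) cheb c i.+1.
  apply: ler_sum => i _; apply: le_trans (cheb_ge i.+1 c01).
  have : (i.+1%:R : R) ^+ 2 <= n%:R ^+ 2.
    by rewrite -!natrX ler_nat leq_exp2r// ltn_ord.
  by move: c01 => /andP[? ?]; nra.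
rewrite sumr_const card_ord -mulr_natr in H.
by rewrite /dirichlet; lra.
Qed.

Lemma dirichlet_le_n c n : 0 <= c <= 1 -> `|dirichlet c n| <= 2 * n%:R + 1.
Proof.
move=> c01; rewrite /dirichlet (le_trans (ler_normD _ _))// normr1 addrC lerD2r.
rewrite normrM ger0_norm// ler_pM2l// (le_trans (ler_norm_sum _ _ _))//.
rewrite -[leRHS](_ : \sum_(i < n) 1 = _); last by rewrite sumr_const card_ord.
by apply: ler_sum => i _; exact: cheb_le1.
Qed.

(** This is |sin (t / 2)| * |dirichlet| <= 1, the decay of the kernel away from its
peak; squaring the telescoped sum reduces it to the conserved quantity. *)
Lemma dirichlet_le_decay c n : 0 <= c <= 1 -> (1 - c) * dirichlet c n ^+ 2 <= 2.
Proof.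
move=> /andP[c0]; rewrite le_eqVlt => /predU1P[->|c1]; first by lra.
have c10 : 0 < 1 - c by lra.
rewrite -(ler_pM2l c10).
have -> : (1 - c) * ((1 - c) * dirichlet c n ^+ 2) = (cheb c n - cheb c n.+1) ^+ 2.
  by rewrite -dirichlet_telescope; ring.
have := cheb_invariant c n; set a := cheb c n; set b := cheb c n.+1 => ab.
have : (1 + c) * (1 - c + 2 * (a * b)) = (a + b) ^+ 2.
  by apply: subr0_eq; rewrite -(subrr (1 - c ^+ 2)) -{2}ab; ring.
have := sqr_ge0 (a + b) => ? E.
have : 0 <= 1 - c + 2 * (a * b).
  by rewrite -(@pmulr_rge0 _ (1 + c)) ?E//; lra.
move=> ?.
have -> : (a - b) ^+ 2 = (1 - c) * (1 + c - 2 * (a * b)).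
  by apply: subr0_eq; rewrite -(subrr (1 - c ^+ 2)) -{1}ab; ring.
by rewrite ler_pM2l//; lra.
Qed.

End Chebyshev.

(** * A concentrated kernel of low frequency *)

Section CosineBounds.
Context {R : realType}.
Implicit Types x : R.

(** Comparison of derivatives: starting from cos <= 1, repeated use of it yields
sin x <= x and then the quadratic bounds on 1 - cos. *)
Lemma ge0_deriv_ge0 (f df : R -> R) x : (forall y, is_derive y (1 : R) f (df y)) ->
  f 0 = 0 -> 0 <= x -> (forall y, 0 <= y <= x -> 0 <= df y) -> 0 <= f x.
Proof.
move=> fdf f0 x0 df0.
have cf : {within `[0, x], continuous f}.
  apply: continuous_subspaceT => y; apply: differentiable_continuous.
  by apply/derivable1_diffP; apply: ex_derive.
have [c /[!in_itv]/= c0x] := MVT_segment x0 (fun y _ => fdf y) cf.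
by rewrite f0 !subr0 => ->; rewrite mulr_ge0// df0.
Qed.

Lemma sin_le x : 0 <= x -> sin x <= x.
Proof.
move=> x0; rewrite -subr_ge0.
apply: (@ge0_deriv_ge0 (fun y => y - sin y) (fun y => 1 - cos y)) => //.
by rewrite sin0 subr0.
Qed.

Lemma onem_cos_le x : 1 - cos x <= x ^+ 2 / 2.
Proof.
wlog x0 : x / 0 <= x.
  move=> H; have [/H//|x0] := leP 0 x.
  by rewrite -cosN -sqrrN; apply: H; rewrite oppr_ge0 ltW.
rewrite -subr_ge0.
apply: (@ge0_deriv_ge0 (fun y => y ^+ 2 / 2 - (1 - cos y)) (fun y => y - sin y)) => [y|||] //.
- by apply: is_derive_eq; rewrite /GRing.scale/=; field.
- by rewrite cos0; ring.
- by move=> y /andP[y0 _]; rewrite subr_ge0 sin_le.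
Qed.

Lemma onem_cos_ge x : `|x| <= 1 -> x ^+ 2 / 4 <= 1 - cos x.
Proof.
wlog x0 : x / 0 <= x.
  move=> H; have [/H//|x0] := leP 0 x.
  by rewrite -cosN -sqrrN -normrN; apply: H; rewrite oppr_ge0 ltW.
rewrite ger0_norm// => x1; rewrite -subr_ge0.
apply: (@ge0_deriv_ge0 (fun y => (1 - cos y) - y ^+ 2 / 4) (fun y => sin y - y / 2)) => [y|||] //.
- by apply: is_derive_eq; rewrite /GRing.scale/=; field.
- by rewrite cos0; ring.
- move=> y /andP[y0 yx].
  apply: (@ge0_deriv_ge0 (fun y => sin y - y / 2) (fun y => cos y - 1/2)) => [z|||] //.
  + by apply: is_derive_eq; rewrite /GRing.scale/=; field.
  + by rewrite sin0; ring.
  + move=> z /andP[z0 zy]; have := onem_cos_le z.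
    have : z ^+ 2 <= 1 by rewrite expr_le1//; lra.
    by lra.
Qed.

Lemma cos_ge_half x : `|x| <= 1 -> 2^-1 <= cos x.
Proof.
move=> x1; have := onem_cos_le x.
have : x ^+ 2 <= 1 by rewrite -(real_normK (num_real x)) expr_le1.
by lra.
Qed.

End CosineBounds.

Section Kernel.
Context {R : realType}.

Lemma cosine_sum_continuous (W M : R) Q : cosine_sum W M Q -> continuous Q.
Proof.
move=> [s [QE _ _]] t; rewrite (_ : Q = (fun t => \sum_(p <- s) p.1 * cos (p.2 * t))).
  elim: {QE} s => [|p s IH].
    rewrite (_ : (fun _ => _) = cst 0); first exact: cvg_cst.
    by apply/funext => u; rewrite big_nil.
  rewrite (_ : (fun _ => _) =
    (fun t => p.1 * cos (p.2 * t) + \sum_(p <- s) p.1 * cos (p.2 * t))); last first.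
    by apply/funext => u; rewrite big_cons.
  apply: cvgD => //; apply: cvgM; first exact: cvg_cst.
  apply: (@continuous_comp _ _ _ (fun t => p.2 * t) cos); last exact: continuous_cos.
  exact: mulrl_continuous.
exact/funext.
Qed.

Lemma cosine_sum_cheb (W A : R) (c : R -> R) n : 0 <= W -> 1 <= A ->
  cosine_sum W A c ->
  cosine_sum (W * n%:R) ((2 * A + 1) ^+ n) (fun t => cheb (c t) n).
Proof.
move=> W0 A1 cA.
suff : cosine_sum (W * n%:R) ((2 * A + 1) ^+ n) (fun t => cheb (c t) n) /\
  cosine_sum (W * n.+1%:R) ((2 * A + 1) ^+ n.+1) (fun t => cheb (c t) n.+1) by case.
elim: n => [|n [IH1 IH2]].
  split.
    by have := @cosine_sum_cst R 1; apply: cosine_sumW => //; rewrite ?normr1 ?mulr0.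
  by apply: cosine_sumW cA; rewrite ?mulr1// expr1; lra.
split=> //.
have H1 := cosine_sumM (cosine_sumM (cosine_sum_cst 2) cA) IH2.
have H2 := cosine_sumM (cosine_sum_cst (-1)) IH1.
have H3 : cosine_sum (W * n.+2%:R) (2 * A * (2 * A + 1) ^+ n.+1)
    (fun t => 2 * c t * cheb (c t) n.+1).
  apply: cosine_sumW H1; last by rewrite ger0_norm.
  by rewrite add0r -[n.+2%:R]natr1 mulrDr mulr1 addrC.
have H4 : cosine_sum (W * n.+2%:R) ((2 * A + 1) ^+ n.+1)
    (fun t => - 1 * cheb (c t) n).
  apply: cosine_sumW H2.
    by rewrite add0r ler_wpM2l// ler_nat; apply: leqW.
  by rewrite normrN normr1 mul1r ler_eXn2l ?leqnSn//; lra.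
have := cosine_sumD H3 H4.
have -> : 2 * A * (2 * A + 1) ^+ n.+1 + (2 * A + 1) ^+ n.+1 = (2 * A + 1) ^+ n.+2.
  by rewrite [RHS]exprS; ring.
rewrite (_ : (fun t => cheb (c t) n.+2) =
  (fun t => 2 * c t * cheb (c t) n.+1 + -1 * cheb (c t) n))//.
by apply/funext => t; rewrite chebSS mulN1r.
Qed.

Lemma cosine_sum_dirichlet (W A : R) (c : R -> R) n : 0 <= W -> 1 <= A ->
  cosine_sum W A c ->
  cosine_sum (W * n%:R) ((6 * A + 3) ^+ n) (fun t => dirichlet (c t) n).
Proof.
move=> W0 A1 cA.
suff H : cosine_sum (W * n%:R) ((2 * n%:R + 1) * (2 * A + 1) ^+ n)
    (fun t => dirichlet (c t) n).
  apply: cosine_sumW H => //.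
  rewrite (_ : 6 * A + 3 = 3 * (2 * A + 1)); last by ring.
  rewrite exprMn ler_wpM2r ?exprn_ge0//; first by lra.
  elim: n => [|n IH]; first by rewrite mulr0 add0r expr0.
  by rewrite exprS -natr1; have := ler0n R n; lra.
elim: n => [|n IH].
  rewrite !mulr0 add0r mul1r expr0 (_ : (fun _ => _) = cst 1).
    by have := @cosine_sum_cst R 1; rewrite normr1.
  by apply/funext => t; rewrite /dirichlet big_ord0 mulr0 addr0.
have H1 := cosine_sumM (cosine_sum_cst 2) (cosine_sum_cheb n.+1 W0 A1 cA).
rewrite add0r ger0_norm// in H1.
have {}IH : cosine_sum (W * n.+1%:R) ((2 * n%:R + 1) * (2 * A + 1) ^+ n.+1)
    (fun t => dirichlet (c t) n).
  apply: cosine_sumW IH; first by rewrite ler_wpM2l// ler_nat.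
  by rewrite ler_wpM2l ?addr_ge0 ?mulr_ge0// ler_eXn2l//; lra.
have := cosine_sumD IH H1; rewrite -mulrDl -natr1.
rewrite (_ : 2 * n%:R + 1 + 2 = 2 * (n%:R + 1) + 1); last by ring.
rewrite (_ : (fun t => dirichlet (c t) n.+1) =
  (fun t => dirichlet (c t) n + cst 2 t * cheb (c t) n.+1))//.
by apply/funext => t; rewrite dirichletS.
Qed.

(** Superoscillation: a cosine sum with frequencies at most 1/2 that nevertheless
looks, on [-2, 2], like a Jackson kernel of width 1/N.  Substitute
c (t) = 1 - B + B cos (w t) with w = 1/(12 N) and B = 1/(2 w^2), so that
1 - c (t) is about t^2/4 on [-2, 2], in the Dirichlet kernel of degree N.  The
sixth power multiplies the top frequency N w = 1/12 by six, hence the band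
1/2; the amplification B ~ N^2 in each of the 6 N factors is responsible for the
cost (30 N)^(12 N).  The power six leaves enough decay for an extra
t / lorentz (t) in the energy estimate. *)
Lemma concentrated_kernel (N : nat) : (0 < N)%N ->
  exists Q : R -> R,
  [/\ cosine_sum 2^-1 ((30 * N%:R) ^+ (12 * N)) Q,
      forall t, `|t| <= 2 -> 0 <= Q t <= (25 * N%:R ^+ 2 / (1 + (N%:R * t) ^+ 2)) ^+ 3 &
      forall t, `|t| <= N%:R^-1 -> N%:R ^+ 6 <= Q t].
Proof.
move=> N0.
have n1 : 1 <= N%:R :> R by rewrite ler1n.
set n : R := N%:R in n1 *.
pose w : R := (12 * n)^-1.
have w0 : 0 < w by rewrite invr_gt0; lra.
have wn : w * n = 12^-1 by rewrite /w; field; lra.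
pose B : R := (2 * w ^+ 2)^-1.
have B0 : 0 < B by rewrite invr_gt0 mulr_gt0// exprn_gt0.
have Bw : B * w ^+ 2 = 2^-1 by rewrite /B; field; lra.
have BE : B = 72 * n ^+ 2 by rewrite /B /w; field; lra.
pose c t : R := (1 - B) + B * cos (w * t).
have cA : cosine_sum w (2 * B) c.
  have H1 := cosine_sum_cst (1 - B).
  have H2 := cosine_sumM (cosine_sum_cst B) (cosine_sum_cos w).
  rewrite add0r mulr1 (gtr0_norm w0) (gtr0_norm B0) in H2.
  have {}H1 := cosine_sumW (ltW w0) (lexx _) H1.
  apply: cosine_sumW (cosine_sumD H1 H2) => //.
  by rewrite ler0_norm; nra.
have cb (t : R) : `|t| <= 2 -> t ^+ 2 / 8 <= 1 - c t <= t ^+ 2 / 4.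
  move=> t2; have -> : 1 - c t = B * (1 - cos (w * t)) by rewrite /c; ring.
  have wt1 : `|w * t| <= 1.
    rewrite normrM gtr0_norm//.
    apply: (@le_trans _ _ (w * 2)); first by rewrite ler_pM2l.
    by nra.
  have /andP[] : B * ((w * t) ^+ 2 / 4) <= B * (1 - cos (w * t)) <= B * ((w * t) ^+ 2 / 2).
    by rewrite !ler_pM2l// onem_cos_ge// onem_cos_le.
  have -> : B * ((w * t) ^+ 2 / 4) = (B * w ^+ 2) * (t ^+ 2 / 4) by field.
  have -> : B * ((w * t) ^+ 2 / 2) = (B * w ^+ 2) * (t ^+ 2 / 2) by field.
  by rewrite Bw; lra.
have sq4 (t : R) : `|t| <= 2 -> t ^+ 2 <= 4.
  move=> t2; rewrite -(real_normK (num_real t)).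
  by have := normr_ge0 t; nra.
have c01 (t : R) : `|t| <= 2 -> 0 <= c t <= 1.
  by move=> t2; have /andP[? ?] := cb _ t2; have := sq4 _ t2; have := sqr_ge0 t; lra.
exists (fun t => dirichlet (c t) N ^+ 6); split.
- have B1 : 1 <= 2 * B by rewrite BE; nra.
  have := cosine_sumX 6 (cosine_sum_dirichlet N (ltW w0) B1 cA).
  rewrite wn BE => /cosine_sumW; apply; first by lra.
  rewrite -exprM (_ : (12 * N)%N = (2 * (N * 6))%N); last by lia.
  rewrite (exprM _ 2).
  rewrite lerXn2r// ?nnegrE ?sqr_ge0//; [by nra|by nra].
- move=> t t2.
  have c01t := c01 _ t2; have /andP[cb1 cb2] := cb _ t2.
  rewrite (exprM _ 2 3) exprn_ge0 ?sqr_ge0//=.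
  have nt0 : 0 < 1 + (n * t) ^+ 2 by rewrite ltr_pwDl// sqr_ge0.
  rewrite lerXn2r// ?nnegrE ?sqr_ge0//.
    by apply: divr_ge0; [rewrite mulr_ge0// sqr_ge0 | exact: ltW].
  rewrite ler_pdivlMr//.
  have d1 : dirichlet (c t) N ^+ 2 <= 9 * n ^+ 2.
    rewrite -(real_normK (num_real _)).
    have := dirichlet_le_n N c01t; rewrite -/n => d1.
    by have := normr_ge0 (dirichlet (c t) N); nra.
  have := dirichlet_le_decay N c01t => d2.
  have d3 : t ^+ 2 * dirichlet (c t) N ^+ 2 <= 16.
    by have := sqr_ge0 (dirichlet (c t) N); nra.
  by have := sqr_ge0 n; rewrite exprMn; nra.
- move=> t tn.
  have t2 : `|t| <= 2.
    by apply: le_trans tn _; rewrite invf_ple ?posrE; lra.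
  suff H : n <= dirichlet (c t) N.
    by rewrite lerXn2r ?nnegrE//; lra.
  apply: dirichlet_ge; first exact: c01.
  have /andP[_ ct] := cb _ t2.
  have : n ^+ 2 * t ^+ 2 <= 1.
    rewrite -exprMn -(real_normK (num_real (n * t))) expr_le1// normrM ger0_norm ?ler0n//.
    by rewrite mulrC -ler_pdivlMr ?div1r//; lra.
  rewrite -/n; have := sqr_ge0 n; nra.
Qed.

End Kernel.

(** * Smooth functions and a smooth step *)

Section SmoothFunctions.
Context {R : realType}.
Implicit Types (f g : R -> R) (x : R).

(** Differentiability with an explicit derivative at each stage: products,
quotients and affine substitutions are then handled by induction on the order,
which the iterated derivative [f^`(n)] does not allow directly. *)
Fixpoint times_derivable (n : nat) (f : R -> R) : Prop :=
  if n is m.+1 then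
    exists2 g, (forall x, is_derive x (1 : R) f (g x)) & times_derivable m g
  else True.

Definition smooth f := forall n, times_derivable n f.

Lemma times_derivableS n f : times_derivable n.+1 f -> times_derivable n f.
Proof.
by elim: n f => [//|n IH] f [g fg gn]; exists g => //; exact: IH.
Qed.

Lemma is_derive_derive1 f g : (forall x, is_derive x (1 : R) f (g x)) ->
  f^`()%classic = g.
Proof. by move=> fg; apply/funext => x; rewrite derive1E; exact: derive_val. Qed.

Lemma smooth_derivable1n f n x : smooth f -> derivable (f^`(n))%classic x 1.
Proof.
move=> /(_ n.+1); elim: n f => [|n IH] f [g fg gn].
  by apply: ex_derive; exact: fg.
by rewrite derive1Sn (is_derive_derive1 fg); exact: IH.
Qed.

Lemma smooth_derive1 f : smooth f ->
  (forall x, is_derive x (1 : R) f (f^`()%classic x)) /\ smooth f^`()%classic.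
Proof.
move=> sf; split.
  by move=> x; have [g fg _] := sf 1%N; rewrite (is_derive_derive1 fg).
by move=> n; have [g fg gn] := sf n.+1; rewrite (is_derive_derive1 fg).
Qed.

Lemma smooth_continuous f : smooth f -> continuous f.
Proof.
move=> sf x; have [/(_ x) fx _] := smooth_derive1 sf.
by apply: differentiable_continuous; apply/derivable1_diffP; apply: ex_derive.
Qed.

Lemma times_derivable_cst n (a : R) : times_derivable n (cst a).
Proof.
elim: n a => [//|n IH] a; exists (cst 0) => // x; exact: is_derive_cst.
Qed.

Lemma times_derivableD n f g : times_derivable n f -> times_derivable n g ->
  times_derivable n (fun x => f x + g x).
Proof.
elim: n f g => [//|n IH] f g [f' ff' f'n] [g' gg' g'n].
by exists (fun x => f' x + g' x) => [x|]; [exact: is_deriveD|exact: IH].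
Qed.

Lemma times_derivableM n f g : times_derivable n f -> times_derivable n g ->
  times_derivable n (fun x => f x * g x).
Proof.
elim: n f g => [//|n IH] f g /[dup] /times_derivableS fn [f' ff' f'n]
  /[dup] /times_derivableS gn [g' gg' g'n].
exists (fun x => f' x * g x + f x * g' x) => [x|].
  by apply: is_derive_eq; rewrite /GRing.scale/=; ring.
by apply: times_derivableD; exact: IH.
Qed.

Lemma is_derive_inv x : x != 0 -> is_derive x (1 : R) (fun y : R => y^-1) (- x ^- 2).
Proof.
move=> x0; apply: DeriveDef; first exact: derivableV.
by rewrite deriveV// derive_id /GRing.scale/= mulr1.
Qed.

Lemma times_derivableV n f : (forall x, f x != 0) -> times_derivable n f ->
  times_derivable n (fun x => (f x)^-1).
Proof.
move=> f0; elim: n => [//|n IH] /[dup] /times_derivableS fn [f' ff' f'n].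
exists (fun x => - 1 * (f' x * ((f x)^-1 * (f x)^-1))) => [x|].
  have := @is_derive1_comp _ (fun y => y^-1) f x _ _ (is_derive_inv (f0 x)) (ff' x).
  by move=> /is_derive_eq; apply; rewrite expr2 invfM; ring.
have fV := IH fn; apply: times_derivableM; first exact: times_derivable_cst.
by apply: times_derivableM => //; exact: times_derivableM.
Qed.

Lemma times_derivable_affine n f (a b : R) : times_derivable n f ->
  times_derivable n (fun x => f (a * x + b)).
Proof.
elim: n f => [//|n IH] f [f' ff' f'n].
exists (fun x => a * f' (a * x + b)) => [x|].
  have axb : is_derive x (1 : R) (fun x : R => a * x + b) a.
    by apply: is_derive_eq; rewrite /GRing.scale/=; ring.
  have := @is_derive1_comp _ f (fun x => a * x + b) x _ _ (ff' _) axb.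
  by move=> /is_derive_eq; apply; rewrite mulrC.
by apply: times_derivableM; [exact: times_derivable_cst|exact: IH].
Qed.

End SmoothFunctions.

Section SmoothStep.
Context {R : realType}.
Implicit Types (p : {poly R}) (x y : R).

(** The family p(1/x) exp (-1/x), extended by 0 to x <= 0.  It is closed under
differentiation, which is what makes exp (-1/x) smooth at the origin. *)
Definition flat p x : R := if 0 < x then p.[x^-1] * expR (- x^-1) else 0.

(** The exponential beats every power: y^(i+1) / (i+1)! <= exp y. *)
Lemma horner_expRN_bound p : exists2 C : R, 0 <= C &
  forall y, 0 < y -> `|p.[y]| * expR (- y) <= C / y.
Proof.
exists (\sum_(i < size p) `|p`_i| * i.+1`!%:R).
  by apply: sumr_ge0 => i _; rewrite mulr_ge0.
move=> y y0; rewrite horner_coef.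
apply: (@le_trans _ _ ((\sum_(i < size p) `|p`_i * y ^+ i|) * expR (- y))).
  by rewrite ler_wpM2r ?expR_ge0// ler_norm_sum.
rewrite !mulr_suml ler_sum// => i _.
rewrite normrM -!mulrA ler_wpM2l// (ger0_norm (exprn_ge0 _ (ltW y0))).
rewrite expRN ler_pdivrMr ?expR_gt0//.
rewrite mulrAC ler_pdivlMr// -exprSr mulrC -ler_pdivrMr ?ltr0n ?fact_gt0//.
by rewrite (le_trans _ (expR_ge1Dxn i (ltW y0)))// lerDr.
Qed.

(** A quadratic bound at the origin is all that is needed to differentiate there. *)
Lemma flat_quadratic p : exists2 C : R, 0 <= C & forall x, `|flat p x| <= C * x ^+ 2.
Proof.
have [C C0 pC] := horner_expRN_bound (p * 'X); exists C => // x.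
rewrite /flat; case: ltP => [x0|_]; last by rewrite normr0 mulr_ge0// sqr_ge0.
have x'0 : 0 < x^-1 by rewrite invr_gt0.
have := pC _ x'0; rewrite hornerMX normrM (gtr0_norm x'0) invrK.
rewrite normrM (ger0_norm (expR_ge0 _)) mulrAC ler_pdivrMr//.
by rewrite -mulrA expr2.
Qed.

Lemma is_derive_flat p x :
  is_derive x (1 : R) (flat p) (flat ('X^2 * (p - p^`())) x).
Proof.
have [x0|x0|->] := ltgtP x 0.
- have -> : flat ('X^2 * (p - p^`())) x = 0 by rewrite /flat ltNge (ltW x0).
  have := @is_derive_cst R _ _ (0 : R) x 1; apply: near_eq_is_derive.
  near=> y; rewrite /flat ltNge; suff -> : y <= 0 by [].
  by apply: ltW; near: y; exact: lt_nbhsl.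
- rewrite {2}/flat x0.
  apply: (@near_eq_is_derive _ _ _ (fun y => p.[y^-1] * expR (- y^-1))).
    near=> y; rewrite /flat; suff -> : 0 < y by [].
    by near: y; exact: lt_nbhsr.
  have xn0 : x != 0 by rewrite gt_eqF.
  have dV : is_derive x (1 : R) (fun y : R => y^-1) (- x ^- 2).
    exact: is_derive_inv.
  have dp : is_derive x (1 : R) (fun y => p.[y^-1]) (p^`().[x^-1] * - x ^- 2).
    exact: (@is_derive1_comp _ (horner p) (fun y => y^-1)).
  have de : is_derive x (1 : R) (fun y => expR (- y^-1)) (expR (- x^-1) * x ^- 2).
    apply: (@is_derive1_comp _ expR (fun y => - y^-1)).
    by apply: is_derive_eq; rewrite opprK.
  apply: is_derive_eq; rewrite /GRing.scale/=.
  by rewrite hornerM hornerXn hornerD hornerN exprVn; ring.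
- rewrite {2}/flat ltxx.
  have [C C0 pC] := flat_quadratic p.
  suff : h^-1 *: (flat p (h *: (1 : R) + 0) - flat p 0) @[h --> 0^'] --> (0 : R).
    by move=> H; apply: DeriveDef; [apply/cvg_ex; exists 0|exact: cvg_lim].
  apply/cvgrPdist_le => e e0; near=> h.
  rewrite sub0r normrN addr0 [X in _ - X]/flat ltxx subr0 normrZ.
  rewrite /GRing.scale/= mulr1 normfV ler_pdivrMl ?normr_gt0; last first.
    by near: h; exact: nbhs_dnbhs_neq.
  rewrite (le_trans (pC _))// -(real_normK (num_real h)) expr2 mulrA mulrC.
  rewrite ler_wpM2l//.
  have : `|h| <= e / (C + 1).
    by near: h; apply: dnbhs0_le; rewrite divr_gt0//; lra.
  rewrite ler_pdivlMr; last by lra.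
  by have := normr_ge0 h; nra.
Unshelve. all: end_near. Qed.

Lemma flat_smooth p : smooth (flat p).
Proof.
move=> n; elim: n p => [//|n IH] p.
by exists (flat ('X^2 * (p - p^`()))) => // x; exact: is_derive_flat.
Qed.

(** The classical partition E(x) / (E(x) + E(1 - x)) with E = exp (-1/x). *)
Lemma smooth_step : exists Phi : R -> R,
  [/\ smooth Phi, forall x, x <= 0 -> Phi x = 0, forall x, 1 <= x -> Phi x = 1
    & forall x, 0 <= Phi x <= 1].
Proof.
pose E := flat 1; pose S x := E x + E (-1 * x + 1).
have E0 x : 0 <= E x by rewrite /E /flat; case: ifP => // _; rewrite hornerC mul1r expR_ge0.
have Epos x : 0 < x -> 0 < E x by rewrite /E /flat => ->; rewrite hornerC mul1r expR_gt0.
have Eneg x : x <= 0 -> E x = 0 by rewrite /E /flat leNgt => /negbTE ->.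
have S0 x : 0 < S x.
  rewrite /S; have [x0|x0] := ltP 0 x; first by rewrite ltr_pwDl// Epos.
  by rewrite ltr_wpDl// Epos//; lra.
exists (fun x => E x * (S x)^-1); split.
- move=> n; apply: times_derivableM; first exact: flat_smooth.
  apply: times_derivableV => [x|]; first by rewrite gt_eqF.
  apply: times_derivableD; first exact: flat_smooth.
  by apply: times_derivable_affine; exact: flat_smooth.
- by move=> x x0; rewrite Eneg// mul0r.
- move=> x x1; rewrite /S (Eneg (-1 * x + 1)); last by lra.
  by rewrite addr0 divff// gt_eqF// Epos//; lra.
- move=> x; rewrite divr_ge0//=; last exact: ltW.
  by rewrite ler_pdivrMr// mul1r /S lerDl.
Qed.

End SmoothStep.

(** * Integration on the real line *)

Section IntegrationTools.
Context {R : realType}.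
Notation mu := (@lebesgue_measure R).
Implicit Types (D A B : set R) (f g : R -> R).

Lemma integrable_measurable D f : mu.-integrable D (EFin \o f) -> measurable_fun D f.
Proof. by move=> /integrableP[/measurable_EFinP]. Qed.

Lemma integrable_restrictT D f : measurable D ->
  mu.-integrable setT (EFin \o (f \_ D)) <-> mu.-integrable D (EFin \o f).
Proof.
move=> mD; rewrite -restrict_EFin.
by have := @integrable_mkcond _ _ _ mu D (EFin \o f) mD => ->.
Qed.

(** Keeps the sum of two real integrands under a single [EFin], which is the form in
which real-valued integrals present their integrand. *)
Lemma integrable_add D f g : measurable D ->
  mu.-integrable D (EFin \o f) -> mu.-integrable D (EFin \o g) ->
  mu.-integrable D (EFin \o (fun x => f x + g x)).
Proof. by move=> mD fi gi; have := @integrableD _ _ _ mu _ mD _ _ fi gi. Qed.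

Lemma integrable_sub D f g : measurable D ->
  mu.-integrable D (EFin \o f) -> mu.-integrable D (EFin \o g) ->
  mu.-integrable D (EFin \o (fun x => f x - g x)).
Proof. by move=> mD fi gi; have := @integrableB _ _ _ mu _ mD _ _ fi gi. Qed.

Lemma integrable_scale D f (a : R) : measurable D ->
  mu.-integrable D (EFin \o f) -> mu.-integrable D (EFin \o (fun x => a * f x)).
Proof. by move=> mD fi; have := @integrableZl _ _ _ mu _ mD a _ fi. Qed.

Lemma integrable_bounded_mul D f g (M : R) : measurable D ->
  measurable_fun D g -> (forall x, D x -> `|g x| <= M) ->
  mu.-integrable D (EFin \o f) -> mu.-integrable D (EFin \o (fun x => f x * g x)).
Proof.
move=> mD mg gM fi.
have := @integrableMl _ _ _ mu _ mD _ g fi mg; apply.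
exists M; split; first exact: num_real.
by move=> x Mx y Dy; rewrite /= (le_trans (gM _ Dy))// ltW.
Qed.

Lemma integrable_bounded D g (M : R) : measurable D -> (mu D < +oo)%E ->
  measurable_fun D g -> (forall x, D x -> `|g x| <= M) ->
  mu.-integrable D (EFin \o g).
Proof.
move=> mD D_fin mg gM; apply: measurable_bounded_integrable => //.
exists M; split; first exact: num_real.
by move=> x Mx y Dy; rewrite /= (le_trans (gM _ Dy))// ltW.
Qed.

Lemma Rintegral_subset_le A B f : measurable A -> measurable B -> A `<=` B ->
  (forall x, B x -> 0 <= f x) -> mu.-integrable B (EFin \o f) ->
  \int[mu]_(x in A) f x <= \int[mu]_(x in B) f x.
Proof.
move=> mA mB AB f0 fi; have fA : mu.-integrable A (EFin \o f) by apply: integrableS fi.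
rewrite /Rintegral fine_le//; [exact: integrable_fin_num|exact: integrable_fin_num|].
apply: ge0_subset_integral => //; exact: measurable_int fi.
Qed.

Lemma lebesgue_pt_small f x : lebesgue_pt f x -> forall e : R, 0 < e ->
  \forall r \near 0^'+, (\int[mu]_(y in ball x r) `|f y - f x|%:E <= (e * r)%:E)%E.
Proof.
move=> fx e e0.
have e20 : (0 < e / 2) by rewrite divr_gt0.
have /fx : nbhs 0%E [set z : \bar R | (z < (e / 2)%:E)%E].
  by apply: open_nbhs_nbhs; split; [exact: open_ereal_lt_ereal|rewrite /= lte_fin].
move=> H; have {}H : \forall r \near 0^'+, (davg f x r < (e / 2)%:E)%E := H.
near=> r.
have r0 : 0 < r by near: r; exact: nbhs_right_gt.
have : (davg f x r < (e / 2)%:E)%E by near: r; exact: H.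
rewrite /davg /iavg (lebesgue_measure_ball _ (ltW r0)) inver mulrn_eq0/= gt_eqF//.
move/ltW; rewrite lee_pdivrMl ?mulrn_wgt0// => /le_trans; apply.
by rewrite -EFinM lee_fin -mulr_natl; lra.
Unshelve. all: end_near. Qed.

End IntegrationTools.

(** * Approximate identities from a smooth step *)

Section SmoothStepIntegrals.
Context {R : realType}.
Notation mu := (@lebesgue_measure R).
Implicit Types (f g : R -> R) (x y : R).

Lemma Rintegral_is_derive f g (a b : R) : a < b ->
  (forall x, is_derive x (1 : R) f (g x)) -> continuous g ->
  \int[mu]_(x in `[a, b]) g x = f b - f a.
Proof.
move=> ab fg cg.
have cf : continuous f.
  move=> x; apply: differentiable_continuous; apply/derivable1_diffP.
  by apply: ex_derive; exact: fg.
rewrite /Rintegral (@continuous_FTC2 _ g f)//.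
- exact: continuous_subspaceT.
- split; [|apply: cvg_at_right_filter; exact: cf|apply: cvg_at_left_filter; exact: cf].
  by move=> x _; apply: ex_derive; exact: fg.
- by move=> x _; rewrite (is_derive_derive1 fg).
Qed.

Lemma smooth_step_with_bounded_slope : exists Phi : R -> R,
  [/\ smooth Phi, forall x, x <= 0 -> Phi x = 0, forall x, 1 <= x -> Phi x = 1,
      forall x, 0 <= Phi x <= 1
    & exists2 M : R, 0 < M & forall x, `|Phi^`()%classic x| <= M *+ (0 <= x <= 1)%R].
Proof.
have [Phi [sP P0 P1 P01]] := @smooth_step R; exists Phi; split => //.
have [dP sdP] := smooth_derive1 sP.
have cdP := smooth_continuous sdP.
have [c _ cmax] : exists2 c, c \in `[(0:R), 1] & forall t, t \in `[(0:R), 1] ->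
    `|Phi^`()%classic t| <= `|Phi^`()%classic c|.
  apply: EVT_max => //; apply: continuous_subspaceT => x.
  by apply: continuous_comp; [exact: cdP|exact: norm_continuous].
exists (`|Phi^`()%classic c| + 1); first by rewrite ltr_wpDl.
move=> x; have [x01|] := boolP (0 <= x <= 1); first by rewrite mulr1n (le_trans (cmax x _)) ?in_itv// lerDl.
(* Outside [0, 1] the step is locally constant. *)
rewrite mulr0n negb_and -!ltNge => /orP[x0|x1].
  have <- : (cst (0 : R))^`()%classic x = Phi^`()%classic x.
    rewrite !derive1E; apply: near_eq_derive; near=> y; rewrite P0//.
    by apply: ltW; near: y; exact: lt_nbhsl.
  by rewrite derive1_cst normr0.
have <- : (cst (1 : R))^`()%classic x = Phi^`()%classic x.
  rewrite !derive1E; apply: near_eq_derive; near=> y; rewrite P1//.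
  by apply: ltW; near: y; exact: lt_nbhsr.
by rewrite derive1_cst normr0.
Unshelve. all: end_near. Qed.

Lemma measurable_I11 : measurable (I11 : set R).
Proof. exact: measurable_itv. Qed.

Lemma mu_I11 : mu (I11 : set R) = 2%:E.
Proof.
rewrite /I11 lebesgue_measure_itv/= lte_fin ifT; last by lra.
by rewrite -EFinD; congr EFin; lra.
Qed.

(** Derivative of the step [Phi] rescaled to climb from 0 to 1 on [x, x + d]: an
approximate identity at x as d tends to 0. *)
Definition step_slope (Phi : R -> R) (d x t : R) : R :=
  d^-1 * Phi^`()%classic (d^-1 * t - x / d).

Lemma is_derive_step (Phi : R -> R) (d x t : R) : smooth Phi ->
  is_derive t (1 : R) (fun t : R => Phi (d^-1 * t - x / d)) (step_slope Phi d x t).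
Proof.
move=> /smooth_derive1[dP _].
have dt : is_derive t (1 : R) (fun t : R => d^-1 * t - x / d) d^-1.
  by apply: is_derive_eq; rewrite /GRing.scale/=; ring.
have := @is_derive1_comp _ Phi (fun t => d^-1 * t - x / d) t _ _ (dP _) dt.
by move=> /is_derive_eq; apply; rewrite mulrC.
Qed.

Lemma step_slope_continuous (Phi : R -> R) (d x : R) : smooth Phi ->
  continuous (step_slope Phi d x).
Proof.
move=> /smooth_derive1[_ /smooth_continuous cdP] t.
apply: cvgM; first exact: cvg_cst.
apply: (@continuous_comp _ _ _ (fun t => d^-1 * t - x / d)); last exact: cdP.
by apply: cvgB; [exact: mulrl_continuous|exact: cvg_cst].
Qed.

Lemma step_slope_bound (Phi : R -> R) (M d x t : R) :
  (forall x, `|Phi^`()%classic x| <= M *+ (0 <= x <= 1)%R) -> 0 < d ->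
  `|step_slope Phi d x t| <= M / d *+ (x <= t <= x + d)%R.
Proof.
move=> PM d0; have := PM (d^-1 * t - x / d).
have -> : (0 <= d^-1 * t - x / d <= 1) = (x <= t <= x + d).
  have -> : d^-1 * t - x / d = (t - x) / d by field; lra.
  by rewrite ler_pdivrMr// ler_pdivlMr// mul0r mul1r subr_ge0 lerBlDl.
have d'0 : 0 < d^-1 by rewrite invr_gt0.
rewrite /step_slope normrM (gtr0_norm d'0).
case: (_ <= _ <= _); rewrite ?mulr1n ?mulr0n => H; last by rewrite pmulr_rle0.
by rewrite mulrC ler_pM2r.
Qed.

Lemma integrable_mul_step_slope (Phi : R -> R) (M d x : R) F : smooth Phi ->
  (forall x, `|Phi^`()%classic x| <= M *+ (0 <= x <= 1)%R) -> 0 < d -> 0 < M ->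
  mu.-integrable I11 (EFin \o F) ->
  mu.-integrable I11 (EFin \o (fun t => F t * step_slope Phi d x t)).
Proof.
move=> sP PM d0 M0 iF; apply: (@integrable_bounded_mul _ _ _ _ (M / d)) => //.
- exact: measurable_I11.
- by apply: measurable_funTS; apply: continuous_measurable_fun; exact: step_slope_continuous.
- move=> t _; rewrite (le_trans (step_slope_bound _ _ PM d0))//.
  case: (_ <= _ <= _); rewrite ?mulr1n ?mulr0n//.
  by rewrite divr_ge0// ltW.
Qed.

(** At a Lebesgue point, averages against the approximate identity converge: the
slope has mass 1, is at most M / d, and vanishes outside the ball of radius
2 d, over which the integral of |F - F x| is o(d). *)
Lemma smooth_step_average (Phi : R -> R) (M : R) (F : R -> R) x :
  smooth Phi -> (forall x, x <= 0 -> Phi x = 0) -> (forall x, 1 <= x -> Phi x = 1) ->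
  0 < M -> (forall x, `|Phi^`()%classic x| <= M *+ (0 <= x <= 1)%R) ->
  mu.-integrable setT (EFin \o F) -> lebesgue_pt F x -> -1 < x < 1 ->
  forall e, 0 < e -> \forall d \near 0^'+,
  `|\int[mu]_(t in I11) (F t * step_slope Phi d x t) - F x| <= e.
Proof.
move=> sP P0 P1 M0 PM iF Fx /andP[x0 x1] e e0.
have mI := measurable_I11.
have Ifin : (mu (I11 : set R) < +oo)%E by rewrite mu_I11 ltry.
have mF : measurable_fun setT F := integrable_measurable iF.
have iFI : mu.-integrable I11 (EFin \o F) by apply: integrableS iF.
have eM : 0 < e / M / 2 by rewrite !divr_gt0.
have Fsmall : \forall d \near 0^'+,
    (\int[mu]_(y in ball x (d *+ 2)) `|F y - F x|%:E <= (e / M / 2 * (d *+ 2))%:E)%E.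
  have [r /= r0 H] := lebesgue_pt_small Fx eM.
  near=> d.
  have d0 : 0 < d by near: d; exact: nbhs_right_gt.
  have dr : d < r / 2 by near: d; apply: nbhs_right_lt; rewrite divr_gt0.
  apply: H; last by rewrite mulrn_wgt0.
  by rewrite /= sub0r normrN gtr0_norm ?mulrn_wgt0// -mulr_natl; lra.
near=> d.
have d0 : 0 < d by near: d; exact: nbhs_right_gt.
have dx1 : x + d <= 1.
  rewrite -lerBrDl; near: d; apply: nbhs_right_ltW; lra.
pose k := step_slope Phi d x.
have kM t : `|k t| <= M / d *+ (x <= t <= x + d)%R by exact: step_slope_bound.
have kc : continuous k by exact: step_slope_continuous.
have ik : mu.-integrable I11 (EFin \o k).
  have := @integrable_mul_step_slope Phi M d x (cst 1) sP PM d0 M0.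
  rewrite (_ : (fun _ => _) = k); last by apply/funext => t; rewrite mul1r.
  by apply; apply: (@integrable_bounded _ _ _ 1) => // t _; rewrite normr1.
have iFk : mu.-integrable I11 (EFin \o (fun t => F t * k t)).
  exact: integrable_mul_step_slope PM _ _ _.
have iFxk : mu.-integrable I11 (EFin \o (fun t => F x * k t)).
  exact: integrable_scale.
have kM' t : `|k t| <= M / d.
  rewrite (le_trans (kM t))//; case: (_ <= _ <= _); rewrite ?mulr1n ?mulr0n//.
  by rewrite divr_ge0// ltW.
have dk t := is_derive_step d x t sP.
have k1 : \int[mu]_(t in I11) k t = 1.
  have /Rintegral_is_derive -> // : -1 < 1 :> R by lra.
  rewrite P1 ?P0 ?subr0//.
    rewrite (_ : _ - _ = - (1 + x) / d); last by field; lra.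
    by rewrite ler_pdivrMr// mul0r; lra.
  rewrite (_ : _ - _ = (1 - x) / d); last by field; lra.
  by rewrite ler_pdivlMr// mul1r; lra.
have -> : F x = \int[mu]_(t in I11) (F x * k t) by rewrite RintegralZl// k1 mulr1.
rewrite -RintegralB// -lee_fin EFin_normr_Rintegral//; last first.
  exact: integrable_sub.
have mFk := integrable_measurable (integrable_sub mI iFk iFxk).
pose h y := (M / d * `|F y - F x|)%:E.
have mh : measurable_fun setT h.
  apply/measurable_EFinP; apply: measurable_funM => //.
  by apply: measurableT_comp => //; exact: measurable_funB.
have mball : measurable (ball x (d *+ 2)) by exact: measurable_ball.
have Md0 : 0 <= M / d by rewrite divr_ge0// ltW.
have h0 y : (0 <= h y)%E by rewrite lee_fin mulr_ge0.
apply: (@le_trans _ _ (\int[mu]_(y in ball x (d *+ 2)) h y)%E).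
  apply: (@le_trans _ _ (\int[mu]_(y in I11 `&` ball x (d *+ 2)) h y)%E); last first.
    apply: ge0_subset_integral => //; first exact: measurableI.
    exact: measurable_funTS.
  rewrite integral_mkcondr.
  apply: le_trans (le_abse_integral _ _ _) _ => //.
    exact/measurable_EFinP.
  apply: ge0_le_integral => //.
  - apply: measurableT_comp => //.
    exact/measurable_EFinP.
  - by apply/measurable_restrict => //; exact: measurable_funTS.
  - move=> y _; rewrite patchE; case: ifPn => yb /=; rewrite lee_fin.
      by rewrite -mulrBl normrM mulrC ler_wpM2r// kM'.
    rewrite -mulrBl normrM.
    have := kM y; case: (boolP (x <= y <= x + d)) => [xyd|_].
      exfalso; move: yb; rewrite notin_setE /ball/= => /negP.
      by rewrite -leNgt distrC ger0_norm; lra.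
    by rewrite mulr0n normr_le0 => /eqP ky0; rewrite -/(k y) ky0 normr0 mulr0.
have : (\int[mu]_(y in ball x (d *+ 2)) `|F y - F x|%:E <= (e / M / 2 * (d *+ 2))%:E)%E.
  by near: d; exact: Fsmall.
rewrite /h => H.
under eq_integral do rewrite EFinM.
rewrite ge0_integralZl//; last first.
  apply/measurable_EFinP; apply: measurable_funTS.
  by apply: measurableT_comp => //; exact: measurable_funB.
apply: le_trans (lee_pmul _ _ (lexx _) H) _ => //.
  exact: integral_ge0.
by rewrite -EFinM lee_fin -mulr_natl le_eqVlt; apply/orP; left; apply/eqP; field; lra.
Unshelve. all: end_near. Qed.

End SmoothStepIntegrals.

(** * Increments of a weakly differentiable function *)

Section Increments.
Context {R : realType}.
Notation mu := (@lebesgue_measure R).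
Implicit Types (f u : R -> R) (x y : R).

(** Substitute for the fundamental theorem of calculus.  Test the weak derivative
against a smoothed indicator of the interval between x and y: its derivative is
a difference of two approximate identities, so the left-hand side tends to
f x - f y at Lebesgue points, while the indicator is bounded by 1 and supported
near [x, y].  The slack factor 2 spares the limit of the right-hand side. *)
Lemma weak_derivative_increment f u x y :
  mu.-integrable I11 (EFin \o f) -> mu.-integrable I11 (EFin \o u) ->
  weak_derivative f u ->
  -1 < x < 1 -> lebesgue_pt (f \_ I11) x -> -1 < y < 1 -> lebesgue_pt (f \_ I11) y ->
  `|f x - f y| <= \int[mu]_(t in I11 `&` [set t | `|t - x| <= 2 * `|x - y|]) `|u t|.
Proof.
move=> fi ui fu x11 fx y11 fy.
have [->|xy] := eqVneq x y; first by rewrite subrr normr0 Rintegral_ge0.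
have [Phi [sP P0 P1 P01 [M M0 PM]]] := @smooth_step_with_bounded_slope R.
have mI := @measurable_I11 R.
set S := [set t | _ <= _].
have mS : measurable S.
  rewrite (_ : S = `[x - 2 * `|x - y|, x + 2 * `|x - y|]%classic).
    exact: measurable_itv.
  by apply/seteqP; split => t; rewrite /S/= in_itv/= ler_distl.
apply/ler_addgt0Pr => e e0.
have e20 : 0 < e / 2 by rewrite divr_gt0.
pose F := f \_ I11.
have iF : mu.-integrable setT (EFin \o F).
  exact/integrable_restrictT.
have Ax := smooth_step_average sP P0 P1 M0 PM iF fx x11 e20.
have Ay := smooth_step_average sP P0 P1 M0 PM iF fy y11 e20.
have xy0 : 0 < `|x - y| by rewrite normr_gt0 subr_eq0.
have [d [d0 dxy dx dy [{}Ax {}Ay]]] : exists d : R,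
    [/\ 0 < d, d <= `|x - y|, x + d < 1, y + d < 1 &
    `|\int[mu]_(t in I11) (F t * step_slope Phi d x t) - F x| <= e / 2 /\
    `|\int[mu]_(t in I11) (F t * step_slope Phi d y t) - F y| <= e / 2].
  apply: (@filter_ex _ (0^'+)); near=> d; split.
  - by near: d; exact: nbhs_right_gt.
  - by near: d; exact: nbhs_right_ltW.
  - by rewrite -ltrBrDl; near: d; apply: nbhs_right_lt; lra.
  - by rewrite -ltrBrDl; near: d; apply: nbhs_right_lt; lra.
  - by split; near: d.
pose phi t := Phi (d^-1 * t - x / d) - Phi (d^-1 * t - y / d).
have step0 z t : t <= z -> Phi (d^-1 * t - z / d) = 0.
  move=> tz; apply: P0; rewrite (_ : _ - _ = (t - z) / d); last by field; lra.
  by rewrite ler_pdivrMr// mul0r subr_le0.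
have step1 z t : z + d <= t -> Phi (d^-1 * t - z / d) = 1.
  move=> tz; apply: P1; rewrite (_ : _ - _ = (t - z) / d); last by field; lra.
  by rewrite ler_pdivlMr// mul1r; lra.
have phi0 t : phi t != 0 -> Num.min x y <= t <= Num.max x y + d.
  apply: contraNT; rewrite negb_and -!ltNge => /orP[|].
    rewrite lt_min => /andP[tx ty].
    by rewrite /phi !step0 ?subrr// ltW.
  rewrite -ltrBrDr gt_max => /andP[tx ty].
  by rewrite /phi !step1 ?subrr//; lra.
(* Here d <= |x - y| is used: the smoothed indicator overshoots by d. *)
have phiS t : phi t != 0 -> S t.
  move=> /phi0; rewrite /S /=.
  move: dxy; rewrite /Num.min /Num.max; case: ltP => xy'.
    rewrite distrC (gtr0_norm (_ : 0 < y - x)) ?subr_gt0// => dxy /andP[xt ty].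
    by rewrite ger0_norm; lra.
  rewrite (ger0_norm (_ : 0 <= x - y)) ?subr_ge0// => dxy /andP[xt ty].
  by rewrite ler_norml; lra.
have dphi t : is_derive t (1 : R) phi (step_slope Phi d x t - step_slope Phi d y t).
  by apply: is_deriveB; exact: is_derive_step.
have tphi : test_function phi.
  split.
    move=> n t; apply: smooth_derivable1n => {}n.
    rewrite (_ : phi = (fun t => Phi (d^-1 * t + - (x / d)) + (cst (-1) t) * Phi (d^-1 * t + - (y / d)))).
      apply: times_derivableD; first exact: times_derivable_affine.
      by apply: times_derivableM; [exact: times_derivable_cst|exact: times_derivable_affine].
    by apply/funext => s; rewrite mulN1r.
  have : closure [set t | phi t != 0] `<=` `[Num.min x y, Num.max x y + d]%classic.
    rewrite closureE; apply: smallest_sub; first exact: interval_closed.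
    by move=> t /= /phi0; rewrite in_itv.
  move=> /subset_trans; apply => t /=; rewrite !in_itv/=.
  move: x11 y11 => /andP[? ?] /andP[? ?]; rewrite /Num.min /Num.max.
  by case: ltP => _ /andP[? ?]; apply/andP; split; lra.
pose k := step_slope Phi d.
have ik z : mu.-integrable I11 (EFin \o (fun t => F t * k z t)).
  by apply: integrable_mul_step_slope PM _ _ _ => //; apply: integrableS iF.
have := fu _ tphi; rewrite (is_derive_derive1 dphi).
have -> : \int[leb]_(t in I11) (f t * (k x t - k y t)) =
    \int[mu]_(t in I11) (F t * k x t) - \int[mu]_(t in I11) (F t * k y t).
  rewrite -RintegralB//; apply: eq_Rintegral => t tI.
  by rewrite /F patchE tI mulrBr.
have H : `|\int[leb]_(t in I11) (u t * phi t)| <= \int[mu]_(t in I11 `&` S) `|u t|.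
  have phi1 t : `|phi t| <= 1.
    have := P01 (d^-1 * t - x / d); have := P01 (d^-1 * t - y / d).
    by rewrite /phi ler_norml => /andP[? ?] /andP[? ?]; apply/andP; split; lra.
  have iup : mu.-integrable I11 (EFin \o (fun t => u t * phi t)).
    apply: (@integrable_bounded_mul _ _ _ _ 1) => //.
    apply: measurable_funTS; apply: continuous_measurable_fun => t.
    by apply: differentiable_continuous; apply/derivable1_diffP; apply: ex_derive; exact: dphi.
  have iun : mu.-integrable I11 (EFin \o (fun t => `|u t|)) by exact: integrable_norm.
  rewrite (le_trans (le_normr_Rintegral _ iup))// Rintegral_mkcondr.
  apply: le_Rintegral => //; first exact: integrable_norm.
    rewrite -restrict_EFin; apply/integrable_restrict => //.
    by apply: integrableS iun => //; exact: measurableI.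
  move=> t It; rewrite patchE normrM; case: ifPn => tS.
    by rewrite ler_piMr.
  have -> : phi t = 0.
    by apply/eqP; apply: contraNT tS => /phiS; rewrite inE.
  by rewrite normr0 mulr0.
move=> E.
have Fx : F x = f x.
  by rewrite /F patchE mem_set//= /I11/= in_itv/=; move: x11 => /andP[/ltW -> /ltW ->].
have Fy : F y = f y.
  by rewrite /F patchE mem_set//= /I11/= in_itv/=; move: y11 => /andP[/ltW -> /ltW ->].
move: Ax Ay; rewrite Fx Fy -/(k x) -/(k y).
set A := \int[mu]_(t in I11) (F t * k x t) in E *.
set B := \int[mu]_(t in I11) (F t * k y t) in E *.
set J := \int[leb]_(t in I11) (u t * phi t) in E H *.
move=> Ax Ay; rewrite (_ : f x - f y = - (A - f x) + (B - f y) - J); last by rewrite -[J]opprK -E; ring.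
rewrite (le_trans (ler_normB _ _))// addrC; apply: lerD => //.
rewrite (le_trans (ler_normD _ _))// normrN [e]splitr; exact: lerD.
Unshelve. all: end_near. Qed.
End Increments.

(** * Weighted Cauchy-Schwarz inequality *)

Section LorentzWeight.
Context {R : realType}.
Notation mu := (@lebesgue_measure R).
Implicit Types (n s t x y : R).

(** Weight of width 1/n and total mass about 1/n; its antiderivative is an
arctangent.  It plays the role of a smooth cutoff at the scale of the kernel. *)
Definition lorentz n s : R := (1 + (n * s) ^+ 2)^-1.

Lemma lorentz_gt0 n s : 0 < lorentz n s.
Proof. by rewrite invr_gt0 ltr_pwDl// sqr_ge0. Qed.

Lemma lorentz_le1 n s : lorentz n s <= 1.
Proof. by rewrite invf_le1 ?ltr_pwDl ?sqr_ge0// lerDl sqr_ge0. Qed.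

Lemma lorentz_norm n s : lorentz n `|s| = lorentz n s.
Proof. by rewrite /lorentz !exprMn real_normK ?num_real. Qed.

Lemma lorentz_continuous n : continuous (lorentz n).
Proof.
move=> s; apply: cvgV; first by rewrite gt_eqF// ltr_pwDl// sqr_ge0.
apply: cvgD; first exact: cvg_cst.
by rewrite -[X in X @ _](_ : (fun s => n * s * (n * s)) = _)//;
  apply: cvgM; exact: mulrl_continuous.
Qed.

Lemma lorentz_shift_continuous n x : continuous (fun t => lorentz n (t - x)).
Proof.
move=> t; apply: (@continuous_comp _ _ _ (fun t => t - x)); last exact: lorentz_continuous.
by apply: cvgB; [exact: cvg_id|exact: cvg_cst].
Qed.

Lemma Rintegral_lorentz n x : 0 < n ->
  \int[mu]_(t in I11) lorentz n (t - x) <= 4 / n.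
Proof.
move=> n0.
have dA t : is_derive t (1 : R) (fun t => n^-1 * atan (n * (t - x))) (lorentz n (t - x)).
  have dt : is_derive t (1 : R) (fun t : R => n * (t - x)) n.
    by apply: is_derive_eq; rewrite /GRing.scale/=; ring.
  have da : is_derive (n * (t - x)) (1 : R) (@atan R) (1 + (n * (t - x)) ^+ 2)^-1.
    by apply: DeriveDef; [exact: derivable_atan|rewrite -derive1E derive1_atan].
  have := @is_derive1_comp _ (@atan R) (fun t => n * (t - x)) t _ _ da dt => dc.
  apply: is_derive_eq; rewrite /GRing.scale/= /lorentz; field.
  by rewrite !gt_eqF// ltr_pwDl// sqr_ge0.
have /Rintegral_is_derive -> // : -1 < 1 :> R by lra.
  rewrite -mulrBr mulrC ler_pM2r ?invr_gt0//.
  have := atan_ltpi2 (n * (1 - x)); have := atan_gtNpi2 (n * (-1 - x)).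
  by have := @pihalf_lt2 R; lra.
exact: lorentz_shift_continuous.
Qed.

(** The Cauchy-Schwarz inequality follows from its AM-GM form by optimizing over
l; the case a = 0 is reached by letting l be large. *)
Lemma sqr_le_of_amgm (a b d : R) : 0 <= a -> 0 <= b -> 0 <= d ->
  (forall l, 0 < l -> 2 * d <= l * a + b / l) -> d ^+ 2 <= a * b.
Proof.
move=> a0 b0; rewrite le_eqVlt => /predU1P[<- _|d0 H].
  by rewrite expr0n mulr_ge0.
move: a0; rewrite le_eqVlt => /predU1P[a0|a0].
  have b1 : 0 < (b + 1) / d by rewrite divr_gt0//; lra.
  have := H _ b1; rewrite -a0 mulr0 add0r invf_div mulrA ler_pdivlMr; last by lra.
  by nra.
have := H (d / a) (divr_gt0 d0 a0).
rewrite divfK ?gt_eqF// invf_div mulrA => {}H.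
have : d <= b * a / d by lra.
by rewrite ler_pdivlMr// -expr2 mulrC.
Qed.

(** Cauchy-Schwarz with the weight [lorentz] and its inverse.  The first factor does
not depend on z, so it can be taken out of the integral over y in the energy
estimate, and the second is explicit: the interval has length 4 z, and on it
1 / lorentz is at most 4 / lorentz n z. *)
Lemma sqr_Rintegral_lorentz_le (U : R -> R) n x z : 0 < n -> 0 <= z ->
  mu.-integrable I11 (EFin \o U) ->
  mu.-integrable I11 (EFin \o (fun t => U t ^+ 2)) ->
  (\int[mu]_(t in I11 `&` [set t | `|t - x| <= 2 * z]) `|U t|) ^+ 2 <=
  (\int[mu]_(t in I11) (U t ^+ 2 * lorentz n (t - x))) * (16 * z / lorentz n z).
Proof.
move=> n0 z0 iU iU2.
have mI := @measurable_I11 R.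
set S := [set t | _ <= _].
have SE : S = `[x - 2 * z, x + 2 * z]%classic.
  by apply/seteqP; split => t; rewrite /S/= in_itv/= ler_distl.
have mS : measurable S by rewrite SE; exact: measurable_itv.
have mIS : measurable (I11 `&` S) by exact: measurableI.
have muIS : (mu (I11 `&` S) <= (4 * z)%:E)%E.
  apply: (@le_trans _ _ (mu S)).
    by apply: le_measure; rewrite ?inE.
  rewrite SE lebesgue_measure_itv/= lte_fin; case: ifPn => _.
    by rewrite -EFinD lee_fin; lra.
  by rewrite lee_fin; lra.
have iH : mu.-integrable I11 (EFin \o (fun t => U t ^+ 2 * lorentz n (t - x))).
  apply: (@integrable_bounded_mul _ _ _ _ 1) => //.
    apply: measurable_funTS; apply: continuous_measurable_fun.
    exact: lorentz_shift_continuous.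
  by move=> t _; rewrite ger0_norm ?lorentz_le1// ltW// lorentz_gt0.
set A := \int[mu]_(t in I11) _.
have A0 : 0 <= A.
  by apply: Rintegral_ge0 => t _; rewrite mulr_ge0 ?sqr_ge0// ltW// lorentz_gt0.
pose c := 1 + (n * (2 * z)) ^+ 2.
have cl : c <= 4 / lorentz n z by rewrite /c /lorentz invrK exprMn; nra.
have c0 : 0 < c by rewrite ltr_pwDl// sqr_ge0.
have l0 := lorentz_gt0 n z.
apply: sqr_le_of_amgm => // [||l lp].
- by rewrite divr_ge0 ?mulr_ge0// ltW.
- exact: Rintegral_ge0.
have iUS : mu.-integrable (I11 `&` S) (EFin \o (fun t => `|U t|)).
  by apply: integrable_norm; apply: integrableS iU => //.
have iHS : mu.-integrable (I11 `&` S) (EFin \o (fun t => U t ^+ 2 * lorentz n (t - x))).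
  by apply: integrableS iH => //.
have icS : mu.-integrable (I11 `&` S) (EFin \o (fun t => c / l)).
  apply: (@integrable_bounded _ _ _ `|c / l|) => //.
  exact: le_lt_trans muIS (ltry _).
rewrite -RintegralZl//.
apply: (@le_trans _ _ (\int[mu]_(t in I11 `&` S)
    (l * (U t ^+ 2 * lorentz n (t - x)) + c / l))).
  apply: le_Rintegral => //.
  - exact: integrable_scale.
  - by apply: integrable_add => //; exact: integrable_scale.
  - move=> t [_ /= tS].
    have w0 := lorentz_gt0 n (t - x).
    have wc : (lorentz n (t - x))^-1 <= c.
      rewrite /lorentz invrK /c lerD2l !exprMn ler_pM2l ?exprn_gt0//.
      rewrite -[leLHS](real_normK (num_real _)) -exprMn lerXn2r ?nnegrE//.
      by rewrite mulr_ge0.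
    apply: (@le_trans _ _ (l * (U t ^+ 2 * lorentz n (t - x)) + (lorentz n (t - x))^-1 / l)); last first.
      by rewrite lerD2l ler_pM2r// invr_gt0.
    rewrite -(real_normK (num_real (U t))).
    set w := lorentz n (t - x) in w0 *; set u := `|U t|.
    (* Completing the square in AM-GM. *)
    have -> : l * (u ^+ 2 * w) + w^-1 / l = (l * (w * u) - 1) ^+ 2 / (l * w) + 2 * u.
      by field; rewrite !gt_eqF.
    by rewrite lerDr divr_ge0 ?sqr_ge0// ltW// mulr_gt0.
rewrite RintegralD//; last exact: integrable_scale.
rewrite (@RintegralZl _ _ _ mu _ (fun t => U t ^+ 2 * lorentz n (t - x)))//.
rewrite Rintegral_cst//.
apply: lerD.
  rewrite ler_pM2l//; apply: Rintegral_subset_le => //.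
  by move=> t _; rewrite mulr_ge0 ?sqr_ge0// ltW// lorentz_gt0.
have muf : fine (mu (I11 `&` S)) <= 4 * z.
  rewrite -lee_fin fineK// ge0_fin_numE//.
  exact: le_lt_trans muIS (ltry _).
apply: (@le_trans _ _ (c / l * (4 * z))).
  by rewrite ler_wpM2l// divr_ge0// ltW.
rewrite mulrAC ler_pM2r ?invr_gt0//.
apply: (@le_trans _ _ (4 / lorentz n z * (4 * z))).
  by rewrite ler_wpM2r// mulr_ge0.
by rewrite le_eqVlt; apply/orP; left; apply/eqP; ring.
Qed.

End LorentzWeight.

(** * The power spectrum as a quadratic form *)

Section FourierQuadraticForm.
Context {R : realType}.
Notation mu := (@lebesgue_measure R).
Variables (D : set R) (F : R -> R).
Hypotheses (mD : measurable D) (iF : mu.-integrable D (EFin \o F)).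

Definition fourier_cos (w : R) : R := \int[mu]_(y in D) (F y * cos (w * y)).
Definition fourier_sin (w : R) : R := \int[mu]_(y in D) (F y * sin (w * y)).
Definition fourier_power (w : R) : R := fourier_cos w ^+ 2 + fourier_sin w ^+ 2.

Lemma integrable_mul_cos w : mu.-integrable D (EFin \o (fun y => F y * cos (w * y))).
Proof.
apply: (@integrable_bounded_mul _ _ _ _ 1) => // [|t _]; last exact: cos_max.
apply: measurable_funTS; apply: continuous_measurable_fun => t.
apply: (@continuous_comp _ _ _ (fun t => w * t)); last exact: continuous_cos.
exact: mulrl_continuous.
Qed.

Lemma integrable_mul_sin w : mu.-integrable D (EFin \o (fun y => F y * sin (w * y))).
Proof.
apply: (@integrable_bounded_mul _ _ _ _ 1) => // [|t _]; last exact: sin_max.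
apply: measurable_funTS; apply: continuous_measurable_fun => t.
apply: (@continuous_comp _ _ _ (fun t => w * t)); last exact: continuous_sin.
exact: mulrl_continuous.
Qed.

Lemma convolution_cos w x :
  mu.-integrable D (EFin \o (fun y => F y * cos (w * (x - y)))) /\
  \int[mu]_(y in D) (F y * cos (w * (x - y))) =
  cos (w * x) * fourier_cos w + sin (w * x) * fourier_sin w.
Proof.
have E : (fun y => F y * cos (w * (x - y))) =
  (fun y => cos (w * x) * (F y * cos (w * y)) + sin (w * x) * (F y * sin (w * y))).
  by apply/funext => y; rewrite mulrBr cosB; ring.
rewrite E; split.
  by apply: integrable_add => //; apply: integrable_scale => //;
    [exact: integrable_mul_cos|exact: integrable_mul_sin].
rewrite RintegralD//; [|apply: integrable_scale => //; exact: integrable_mul_cos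
  |apply: integrable_scale => //; exact: integrable_mul_sin].
by rewrite !RintegralZl//; [exact: integrable_mul_sin|exact: integrable_mul_cos].
Qed.

Lemma convolution_cosine_sum (s : seq (R * R)) x :
  let K t := \sum_(p <- s) p.1 * cos (p.2 * t) in
  mu.-integrable D (EFin \o (fun y => F y * K (x - y))) /\
  \int[mu]_(y in D) (F y * K (x - y)) =
  \sum_(p <- s) p.1 * (cos (p.2 * x) * fourier_cos p.2 + sin (p.2 * x) * fourier_sin p.2).
Proof.
elim: s => [|p s [IH1 IH2]] /=.
  rewrite big_nil (_ : (fun y => _) = cst 0).
    split; first by have := @integrable0 _ _ _ mu D.
    by have := @Rintegral_cst _ _ _ mu D mD 0; rewrite mul0r.
  by apply/funext => y; rewrite big_nil mulr0.
have [ic Ec] := convolution_cos p.2 x.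
rewrite big_cons (_ : (fun y => _) = (fun y => p.1 * (F y * cos (p.2 * (x - y))) +
    F y * \sum_(p <- s) p.1 * cos (p.2 * (x - y)))); last first.
  by apply/funext => y; rewrite big_cons; ring.
split; first by apply: integrable_add => //; exact: integrable_scale.
rewrite RintegralD//; last exact: integrable_scale.
by rewrite IH2; congr (_ + _); rewrite RintegralZl// Ec.
Qed.

(** Expanding cos (w (x - y)) shows that the quadratic form with kernel
cos (w (x - y)) is the squared modulus of the Fourier transform at w. *)
Lemma quadratic_form_cosine_sum (s : seq (R * R)) :
  let K t := \sum_(p <- s) p.1 * cos (p.2 * t) in
  mu.-integrable D (EFin \o (fun x => F x * \int[mu]_(y in D) (F y * K (x - y)))) /\
  \int[mu]_(x in D) (F x * \int[mu]_(y in D) (F y * K (x - y))) =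
  \sum_(p <- s) p.1 * fourier_power p.2.
Proof.
move=> K.
rewrite (_ : (fun x => F x * _) = (fun x => F x * \sum_(p <- s) p.1 *
    (cos (p.2 * x) * fourier_cos p.2 + sin (p.2 * x) * fourier_sin p.2))); last first.
  by apply/funext => x; rewrite (convolution_cosine_sum s x).2.
elim: s {K} => [|p s [IH1 IH2]].
  rewrite big_nil (_ : (fun y => _) = cst 0).
    split; first by have := @integrable0 _ _ _ mu D.
    by have := @Rintegral_cst _ _ _ mu D mD 0; rewrite mul0r.
  by apply/funext => y; rewrite big_nil mulr0.
rewrite big_cons (_ : (fun x => _) = (fun x =>
    (p.1 * fourier_cos p.2 * (F x * cos (p.2 * x)) +
     p.1 * fourier_sin p.2 * (F x * sin (p.2 * x))) + F x * \sum_(p <- s) p.1 *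
    (cos (p.2 * x) * fourier_cos p.2 + sin (p.2 * x) * fourier_sin p.2))); last first.
  by apply/funext => y; rewrite big_cons; ring.
have ic := integrable_scale (p.1 * fourier_cos p.2) mD (integrable_mul_cos p.2).
have isn := integrable_scale (p.1 * fourier_sin p.2) mD (integrable_mul_sin p.2).
split; first by apply: integrable_add => //; exact: integrable_add.
rewrite RintegralD//; last exact: integrable_add.
rewrite IH2; congr (_ + _).
rewrite RintegralD// (@RintegralZl _ _ _ mu _ (fun x => F x * cos (p.2 * x)))//;
  last exact: integrable_mul_cos.
rewrite (@RintegralZl _ _ _ mu _ (fun x => F x * sin (p.2 * x)))//;
  last exact: integrable_mul_sin.
by rewrite -/(fourier_cos _) -/(fourier_sin _) /fourier_power; ring.
Qed.

Lemma fourier_powerN w : fourier_power (- w) = fourier_power w.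
Proof.
rewrite /fourier_power /fourier_cos /fourier_sin.
under eq_Rintegral do rewrite mulNr cosN.
under [in X in _ + X ^+ 2]eq_Rintegral do rewrite mulNr sinN mulrN -mulN1r.
rewrite [in X in _ + X ^+ 2]RintegralZl//; last exact: integrable_mul_sin.
by rewrite mulN1r sqrrN.
Qed.

Lemma fourier_power_ge0 w : 0 <= fourier_power w.
Proof. by rewrite addr_ge0// sqr_ge0. Qed.

Lemma trig_transform_continuous (h : R -> R) : continuous h ->
  (forall t, `|h t| <= 1) ->
  continuous (fun w : R => \int[mu]_(y in D) (F y * h (w * y))).
Proof.
move=> ch h1 w.
have mF := integrable_measurable iF.
have hm v : measurable_fun D (fun y => h (v * y)).
  apply: measurable_funTS; apply: continuous_measurable_fun => t.
  apply: (@continuous_comp _ _ _ (fun t => v * t)); last exact: ch.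
  exact: mulrl_continuous.
have := @continuity_under_integral R _ _ mu (fun w y => F y * h (w * y)) D mD (w - 1) (w + 1).
move=> /(_ _ _ (fun y => `|F y|)); apply.
- by move=> v _; apply: (@integrable_bounded_mul _ _ _ _ 1).
- apply: aeW => y Dy v _; apply: cvgM; first exact: cvg_cst.
  have := @continuous_comp _ _ _ (fun t : R => t * y) h v; apply.
    exact: mulrr_continuous.
  exact: ch.
- exact: integrable_norm.
- by move=> v _; apply: aeW => y Dy; rewrite normrM ler_piMr.
- by rewrite inE/= in_itv/=; lra.
Qed.

Lemma fourier_power_continuous : continuous fourier_power.
Proof.
have cc := trig_transform_continuous (@continuous_cos R) (@cos_max R).
have cs := trig_transform_continuous (@continuous_sin R) (@sin_max R).
move=> w; apply: cvgD.
  by apply: (@cvgM _ _ _ _ fourier_cos fourier_cos); exact: cc.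
by apply: (@cvgM _ _ _ _ fourier_sin fourier_sin); exact: cs.
Qed.

End FourierQuadraticForm.

Section Translation.
Context {R : realType}.
Notation mu := (@lebesgue_measure R).

Lemma Rintegral_translate_le (g : R -> R) (w : R) : continuous g ->
  (forall t, 0 <= g t) -> `|w| <= 2^-1 ->
  \int[mu]_(t in `[- 2^-1, 2^-1]) g (t + w) <= \int[mu]_(t in I11) g t.
Proof.
move=> cg g0; rewrite ler_norml => /andP[w1 w2].
have ig : mu.-integrable I11 (EFin \o g).
  apply: continuous_compact_integrable; first exact: segment_compact.
  exact: continuous_subspaceT.
have dF (t : R) : is_derive t (1 : R) (fun t => t + w) 1.
  by apply: is_derive_eq; rewrite addr0.
have F1 := is_derive_derive1 dF.
have cF : continuous (fun t : R => t + w).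
  by move=> t; apply: cvgD; [exact: cvg_id|exact: cvg_cst].
have -> : \int[mu]_(t in `[- 2^-1, 2^-1]) g (t + w) =
    \int[mu]_(t in `[- 2^-1 + w, 2^-1 + w]) g t.
  rewrite /Rintegral; congr fine; apply/esym.
  rewrite (@integration_by_substitution_increasing _ (fun t => t + w) g).
  - by rewrite F1; apply: eq_integral => t _ /=; rewrite mulr1.
  - lra.
  - by move=> x y _ _ xy; rewrite ltrD2r.
  - by rewrite F1 => t _; exact: cvg_cst.
  - by rewrite F1; exact: is_cvg_cst.
  - by rewrite F1; exact: is_cvg_cst.
  - split; [|apply: cvg_at_right_filter; exact: cF|apply: cvg_at_left_filter; exact: cF].
    by move=> x _; apply: ex_derive; exact: dF.
  - exact: continuous_subspaceT.
apply: Rintegral_subset_le => //.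
- exact: measurable_I11.
- by move=> t; rewrite /I11/= !in_itv/= => /andP[? ?]; apply/andP; split; lra.
Qed.

(** Averaging over eta in [-1/2, 1/2] turns point values of g at the frequencies
of the sum into integrals of g over subintervals of [-1, 1]. *)
Lemma Rintegral_sum_translates_le (g : R -> R) (s : seq (R * R)) : continuous g ->
  (forall t, 0 <= g t) -> (forall p, p \in s -> `|p.2| <= 2^-1) ->
  let G eta := \sum_(p <- s) `|p.1| / 2 * (g (eta + p.2) + g (eta + - p.2)) in
  mu.-integrable `[- 2^-1, 2^-1] (EFin \o G) /\
  \int[mu]_(eta in `[- 2^-1, 2^-1]) G eta <=
    (\sum_(p <- s) `|p.1|) * \int[mu]_(w in I11) g w.
Proof.
move=> cg g0; set J : set R := `[- 2^-1, 2^-1]%classic.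
have mJ : measurable J by exact: measurable_itv.
have ig w : mu.-integrable J (EFin \o (fun eta => g (eta + w))).
  apply: continuous_compact_integrable; first exact: segment_compact.
  apply: continuous_subspaceT => t.
  apply: (@continuous_comp _ _ _ (fun t => t + w)); last exact: cg.
  by apply: cvgD; [exact: cvg_id|exact: cvg_cst].
elim: s => [|p s IH] sW /=.
  rewrite (_ : (fun _ => _) = cst 0); last by apply/funext => x; rewrite big_nil.
  split; first by have := @integrable0 _ _ _ mu J.
  by rewrite big_nil mul0r Rintegral_cst// mul0r.
have [|iS Sle] := IH; first by move=> q qs; apply: sW; rewrite inE qs orbT.
have p2 : `|p.2| <= 2^-1 by apply: sW; rewrite mem_head.
have p2' : `|- p.2| <= 2^-1 by rewrite normrN.
have igg : mu.-integrable J (EFin \o (fun eta => g (eta + p.2) + g (eta + - p.2))).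
  exact: integrable_add.
rewrite (_ : (fun eta => _) = (fun eta => `|p.1| / 2 * (g (eta + p.2) + g (eta + - p.2)) +
    \sum_(p <- s) `|p.1| / 2 * (g (eta + p.2) + g (eta + - p.2)))); last first.
  by apply/funext => eta; rewrite big_cons.
split; first by apply: integrable_add => //; exact: integrable_scale.
rewrite RintegralD//; last exact: integrable_scale.
rewrite big_cons mulrDl; apply: lerD => //.
rewrite RintegralZl// RintegralD// -mulrA ler_wpM2l// ler_pdivrMl//.
rewrite mulr_natl mulr2n; apply: lerD; exact: Rintegral_translate_le.
Qed.

End Translation.

(** * Averages against the weight *)

Section LorentzEnergy.
Context {R : realType}.
Notation mu := (@lebesgue_measure R).
Implicit Types (D : set R) (V : R -> R) (n : R).

Definition lorentz_average V n x : R := \int[mu]_(t in I11) (V t * lorentz n (t - x)).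

Lemma integrable_mul_lorentz V n x : mu.-integrable I11 (EFin \o V) ->
  mu.-integrable I11 (EFin \o (fun t => V t * lorentz n (t - x))).
Proof.
move=> iV; apply: (@integrable_bounded_mul _ _ _ _ 1) => //.
- exact: measurable_I11.
- apply: measurable_funTS; apply: continuous_measurable_fun.
  exact: lorentz_shift_continuous.
- by move=> t _; rewrite ger0_norm ?lorentz_le1// ltW// lorentz_gt0.
Qed.

(** Fubini-Tonelli: the weight is even and has mass at most 4 / n. *)
Lemma lorentz_average_energy V n D : 0 < n -> measurable D -> D `<=` I11 ->
  (forall t, 0 <= V t) -> mu.-integrable I11 (EFin \o V) ->
  mu.-integrable D (EFin \o lorentz_average V n) /\
  \int[mu]_(x in D) lorentz_average V n x <= 4 / n * \int[mu]_(t in I11) V t.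
Proof.
move=> n0 mD DI V0 iV.
have mI := @measurable_I11 R.
pose VI := V \_ I11.
have VI0 t : 0 <= VI t by rewrite /VI patchE; case: ifP.
have iVI : mu.-integrable setT (EFin \o VI) by apply/integrable_restrictT.
have mVI : measurable_fun setT VI := integrable_measurable iVI.
pose T := measurableTypeR R.
pose g (z : T * T) : \bar R := ((\1_I11 z.1 : R) * (VI z.2 * lorentz n (z.2 - z.1)))%:E.
have g0 z : (0 <= g z)%E.
  by rewrite lee_fin !mulr_ge0// ltW// lorentz_gt0.
have mg : measurable_fun setT g.
  apply/measurable_EFinP; apply: measurable_funM.
    by apply: (@measurableT_comp _ _ _ _ _ _ (\1_I11 : T -> R)).
  apply: measurable_funM.
    exact: (@measurableT_comp _ _ _ _ _ _ (VI : T -> R)).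
  apply: (@measurableT_comp _ _ _ _ _ _ (lorentz n : T -> R)).
    by apply: continuous_measurable_fun; exact: lorentz_continuous.
  by apply: measurable_funB.
have iw x : mu.-integrable I11 (EFin \o (fun t => V t * lorentz n (t - x))).
  exact: integrable_mul_lorentz.
have wE t x : lorentz n (t - x) = lorentz n (x - t).
  by rewrite -lorentz_norm distrC lorentz_norm.
have iwc t : mu.-integrable I11 (EFin \o (fun x => lorentz n (x - t))).
  have := @integrable_mul_lorentz (cst 1) n t; under eq_fun do rewrite mul1r; apply.
  apply: (@integrable_bounded _ _ _ 1) => //; first by rewrite mu_I11 ltry.
  by move=> ? _; rewrite normr1.
have HE x : I11 x -> (\int[mu]_t g (x, t) = (lorentz_average V n x)%:E)%E.
  move=> Ix; rewrite /lorentz_average /Rintegral fineK; last first.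
    exact: integrable_fin_num (iw x).
  rewrite [RHS]integral_mkcond; apply: eq_integral => t _.
  rewrite /g /= indicE mem_set// mul1r /VI !patchE; case: ifP => //.
  by rewrite mul0r.
have mH : measurable_fun setT (fun x : T => \int[mu]_t g (x, t))%E.
  exact: (measurable_fun_fubini_tonelli_F (m2 := mu) g).
have H0 x : 0 <= lorentz_average V n x.
  by apply: Rintegral_ge0 => t _; rewrite mulr_ge0// ltW// lorentz_gt0.
have mHD : measurable_fun D (lorentz_average V n).
  apply/measurable_EFinP.
  apply: (@eq_measurable_fun _ _ _ _ D (fun x : T => \int[mu]_t g (x, t))%E).
    by move=> x; rewrite inE => /DI /HE.
  exact: measurable_funTS.
have bound : (\int[mu]_(x in D) (lorentz_average V n x)%:E <=
    (4 / n * \int[mu]_(t in I11) V t)%:E)%E.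
  apply: (@le_trans _ _ (\int[mu]_x \int[mu]_t g (x, t))%E).
    rewrite (@eq_integral _ _ _ mu D (fun x => \int[mu]_t g (x, t))%E); last first.
      by move=> x; rewrite inE => /DI /HE.
    apply: ge0_subset_integral => //.
    by move=> x _; apply: integral_ge0.
  rewrite (fubini_tonelli (m1 := mu) (m2 := mu) g)//.
  rewrite -RintegralZl// /Rintegral fineK; last first.
    by apply: (@integrable_fin_num _ _ _ mu _ mI); exact: integrable_scale.
  rewrite [leRHS]integral_mkcond; apply: ge0_le_integral => //.
  - by move=> t _; exact: integral_ge0.
  - exact: (measurable_fun_fubini_tonelli_G (m1 := mu) g).
  - rewrite restrict_EFin; apply/measurable_EFinP; apply: integrable_measurable.
    by apply/integrable_restrictT => //; exact: integrable_scale.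
  - move=> t _; rewrite patchE; case: ifPn => tI; last first.
      rewrite (@eq_integral _ _ _ mu setT (cst 0%E)) ?integral0// => x _.
      by rewrite /g /= /VI patchE (negbTE tI) mul0r mulr0.
    rewrite (@eq_integral _ _ _ mu setT
      ((fun x => (V t * lorentz n (x - t))%:E) \_ I11)); last first.
      move=> x _; rewrite /g/= /VI patchE tI indicE wE patchE.
      by case: ifP => xI; rewrite ?mul1r ?mul0r.
    rewrite -integral_mkcond.
    have it : mu.-integrable I11 (EFin \o (fun x => V t * lorentz n (x - t))).
      exact: integrable_scale.
    rewrite -[leLHS]fineK; last exact: integrable_fin_num it.
    rewrite lee_fin -/(Rintegral _ _ _) RintegralZl// mulrC.
    by rewrite ler_wpM2r// Rintegral_lorentz.
have iH : mu.-integrable D (EFin \o lorentz_average V n).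
  apply/integrableP; split; first exact/measurable_EFinP.
  under eq_integral do rewrite /= ger0_norm//.
  by apply: le_lt_trans bound _; rewrite ltry.
split => //.
rewrite -lee_fin /Rintegral fineK//; exact: integrable_fin_num iH.
Qed.

End LorentzEnergy.

(** * Energy of the kernel quadratic form *)

Section KernelEnergy.
Context {R : realType}.
Notation mu := (@lebesgue_measure R).
Variables (D Z : set R) (F U : R -> R) (N : nat) (Q : R -> R).
Hypotheses (mZ : measurable Z) (Z0 : mu Z = 0) (DE : D = I11 `\` Z).
Hypotheses (iF : mu.-integrable D (EFin \o F))
  (iF2 : mu.-integrable D (EFin \o (fun x => F x ^+ 2)))
  (iU : mu.-integrable I11 (EFin \o U))
  (iU2 : mu.-integrable I11 (EFin \o (fun x => U x ^+ 2))).
Hypothesis increment : forall x y, D x -> D y ->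
  `|F x - F y| <= \int[mu]_(t in I11 `&` [set t | `|t - x| <= 2 * `|x - y|]) `|U t|.
Hypothesis N0 : (0 < N)%N.
Let n : R := N%:R.
Variables (W M : R).
Hypotheses (QM : cosine_sum W M Q) 
  (Qle : forall t, `|t| <= 2 -> 0 <= Q t <= (25 * n ^+ 2 / (1 + (n * t) ^+ 2)) ^+ 3)
  (Qge : forall t, `|t| <= n^-1 -> n ^+ 6 <= Q t).

Let n1 : 1 <= n. Proof. by rewrite ler1n. Qed.
Let n0 : 0 < n. Proof. by have := n1; lra. Qed.
Let mI := @measurable_I11 R.
Let mD : measurable D. Proof. by rewrite DE; exact: measurableD. Qed.
Let DI : D `<=` I11. Proof. by rewrite DE; exact: subIsetl. Qed.

Let dist_D x y : D x -> D y -> `|x - y| <= 2.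
Proof.
move=> /DI + /DI; rewrite /I11/= !in_itv/= => /andP[? ?] /andP[? ?].
by rewrite ler_norml; apply/andP; split; lra.
Qed.

Let H := lorentz_average (fun t => U t ^+ 2) n.

Let H0 x : 0 <= H x.
Proof.
by apply: Rintegral_ge0 => t _; rewrite mulr_ge0 ?sqr_ge0// ltW// lorentz_gt0.
Qed.

(** With z = |x - y| and m = lorentz n z, the increment costs 16 z / m and the kernel
is at most (25 n^2 m)^3.  Since 2 n z m <= 1, what is left is one factor m, with
constant 16 * 25^3 / 2 = 50^3. *)
Lemma kernel_increment_le x y : D x -> D y ->
  (F x - F y) ^+ 2 * Q (x - y) <= 50 ^+ 3 * n ^+ 5 * H x * lorentz n (x - y).
Proof.
move=> Dx Dy; have xy2 := dist_D Dx Dy.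
set z := x - y in xy2 *.
have /andP[Q0 Q1] := Qle xy2.
have Fxy : (F x - F y) ^+ 2 <= H x * (16 * `|z| / lorentz n z).
  rewrite -lorentz_norm.
  apply: le_trans (sqr_Rintegral_lorentz_le x n0 (normr_ge0 z) iU iU2).
  rewrite -(real_normK (num_real (F x - F y))) lerXn2r ?nnegrE//.
    exact: Rintegral_ge0.
  exact: increment.
have l0 := lorentz_gt0 n z.
have nz : 2 * n * `|z| * lorentz n z <= 1.
  rewrite /lorentz ler_pdivrMr ?ltr_pwDl ?sqr_ge0// mul1r exprMn.
  by rewrite -(real_normK (num_real z)); have := sqr_ge0 (n * `|z| - 1); nra.
apply: (@le_trans _ _ ((H x * (16 * `|z| / lorentz n z)) * (25 * n ^+ 2 * lorentz n z) ^+ 3)).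
  by apply: ler_pM => //; exact: sqr_ge0.
have -> : H x * (16 * `|z| / lorentz n z) * (25 * n ^+ 2 * lorentz n z) ^+ 3 =
  (50 ^+ 3 * n ^+ 5 * H x * lorentz n z) * (2 * n * `|z| * lorentz n z).
  by field; rewrite gt_eqF.
rewrite ler_piMr// !mulr_ge0// ?exprn_ge0//; exact: ltW.
Qed.

Section FixedFrequency.
Variable eta : R.
Hypothesis eta_le : `|eta| <= 2^-1.
Let K t := Q t * cos (eta * t).

Let K_bounds x y : D x -> D y -> Q (x - y) / 2 <= K (x - y) <= Q (x - y).
Proof.
move=> Dx Dy; have xy2 := dist_D Dx Dy; have /andP[Q0 _] := Qle xy2.
have e1 : `|eta * (x - y)| <= 1.
  rewrite normrM; have := ler_pM (normr_ge0 _) (normr_ge0 _) eta_le xy2.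
  by rewrite mulVf.
rewrite /K ler_wpM2l ?cos_ge_half//=.
by rewrite ler_piMr// cos_le1.
Qed.

Let cK : continuous K.
Proof.
move=> t; apply: cvgM; first exact: (cosine_sum_continuous QM).
apply: (@continuous_comp _ _ _ (fun t => eta * t)); last exact: continuous_cos.
exact: mulrl_continuous.
Qed.

Let cKx x : continuous (fun y => K (x - y)).
Proof.
move=> y; apply: (@continuous_comp _ _ _ (fun y => x - y)); last exact: cK.
by apply: cvgB; [exact: cvg_cst|exact: cvg_id].
Qed.

Let iK x : mu.-integrable D (EFin \o (fun y => K (x - y))).
Proof.
apply: (@integrableS _ _ _ mu I11) => //.
apply: continuous_compact_integrable; first exact: segment_compact.
apply: continuous_subspaceT; exact: cKx.
Qed.

(** The peak of the kernel has height n^6 and width 1 / n, and at least one of the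
intervals [x, x + 1/n], [x - 1/n, x] lies in [-1, 1].  Removing the null set Z
does not change its measure. *)
Lemma kernel_mass x : D x -> n ^+ 5 / 2 <= \int[mu]_(y in D) K (x - y).
Proof.
move=> Dx; have := DI Dx; rewrite /I11/= in_itv/= => /andP[x1 x2].
have n'1 : n^-1 <= 1 by rewrite invf_le1//.
have n'0 : 0 < n^-1 by rewrite invr_gt0.
(* Left end of a peak interval of length 1/n that stays inside [-1, 1]. *)
pose a := if x <= 0 then x else x - n^-1.
pose B : set R := `[a, a + n^-1]%classic.
have aI : -1 <= a /\ a + n^-1 <= 1 by rewrite /a; case: (leP x 0) => ?; split; lra.
have mB : measurable B by exact: measurable_itv.
have mDB : measurable (D `&` B) by exact: measurableI.
have muB : mu B = n^-1%:E.
  rewrite /B lebesgue_measure_itv/= lte_fin ifT; last by lra.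
  by rewrite -EFinD; congr EFin; ring.
have muDB : mu (D `&` B) = n^-1%:E.
  rewrite (_ : D `&` B = B `\` Z).
    rewrite measureD//.
      rewrite [X in (_ - X)%E](_ : _ = 0%E) ?sube0.
        exact: muB.
      apply/eqP; rewrite -measure_le0 -Z0; apply: le_measure; rewrite ?inE//.
      exact: measurableI.
    by rewrite [X in (X < _)%E]muB ltry.
  rewrite DE; apply/seteqP; split => t; first by move=> [[]].
  move=> [Bt Zt]; split => //; split => //; move: Bt.
  by rewrite /B /I11/= !in_itv/= => /andP[? ?]; apply/andP; split; lra.
apply: (@le_trans _ _ (\int[mu]_(y in D `&` B) K (x - y))); last first.
  apply: Rintegral_subset_le => // y Dy.
  have /andP[+ _] := K_bounds Dx Dy; apply: le_trans.
  by have /andP[Q0 _] := Qle (dist_D Dx Dy); rewrite divr_ge0.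
apply: (@le_trans _ _ (\int[mu]_(y in D `&` B) (n ^+ 6 / 2))).
  rewrite Rintegral_cst// [X in fine X]muDB/=.
  by rewrite le_eqVlt; apply/orP; left; apply/eqP; field; rewrite gt_eqF.
apply: le_Rintegral => //.
- apply: (@integrable_bounded _ _ _ `|n ^+ 6 / 2|) => //.
  by rewrite [X in (X < _)%E]muDB ltry.
- by apply: integrableS (iK x).
- move=> y [Dy By]; have /andP[+ _] := K_bounds Dx Dy; apply: le_trans.
  rewrite ler_pM2r ?invr_gt0//; apply: Qge.
  move: By; rewrite /B/= in_itv/= /a ler_norml.
  by case: (leP x 0) => ? /andP[? ?]; apply/andP; split; lra.
Qed.

(** From F x * F y >= (F x)^2 / 2 - (F x - F y)^2 / 2: the first term sees the mass of
the kernel, the second one is controlled by the derivative. *)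
Lemma pointwise_energy x : D x ->
  mu.-integrable D (EFin \o (fun y => F y * K (x - y))) ->
  n ^+ 5 / 4 * F x ^+ 2 - 2 * 50 ^+ 3 * n ^+ 4 * H x <=
  F x * \int[mu]_(y in D) (F y * K (x - y)).
Proof.
move=> Dx iFK.
have mass := kernel_mass Dx.
pose c := 50 ^+ 3 * n ^+ 5 * H x.
have c0 : 0 <= c by rewrite !mulr_ge0// ?exprn_ge0// ltW.
have iL : mu.-integrable D (EFin \o (fun y => lorentz n (y - x))).
  apply: (@integrableS _ _ _ mu I11) => //.
  apply: continuous_compact_integrable; first exact: segment_compact.
  apply: continuous_subspaceT; exact: lorentz_shift_continuous.
have Lle : \int[mu]_(y in D) lorentz n (y - x) <= 4 / n.
  apply: le_trans (Rintegral_lorentz x n0).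
  apply: Rintegral_subset_le => //.
    by move=> y _; apply: ltW; exact: lorentz_gt0.
  apply: continuous_compact_integrable; first exact: segment_compact.
  apply: continuous_subspaceT; exact: lorentz_shift_continuous.
rewrite -RintegralZl//.
apply: (@le_trans _ _ (\int[mu]_(y in D)
    (F x ^+ 2 / 2 * K (x - y) - c / 2 * lorentz n (y - x)))); last first.
  apply: le_Rintegral => //.
  - by apply: integrable_sub => //; exact: integrable_scale.
  - exact: integrable_scale.
  - move=> y Dy; have /andP[K1 K2] := K_bounds Dx Dy.
    have /andP[Q0 _] := Qle (dist_D Dx Dy).
    have FF := kernel_increment_le Dx Dy.
    have FK : (F x - F y) ^+ 2 * K (x - y) <= c * lorentz n (y - x).
      rewrite -lorentz_norm distrC lorentz_norm.
      by apply: le_trans FF; rewrite ler_wpM2l// sqr_ge0.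
    have K0 : 0 <= K (x - y) by lra.
    have : 0 <= F y ^+ 2 * K (x - y) by rewrite mulr_ge0// sqr_ge0.
    move: FK; rewrite sqrrB; set k := K _; set l := lorentz _ _ => FK FyK.
    by lra.
rewrite RintegralB//; [|exact: integrable_scale..].
rewrite !RintegralZl//.
have h1 : F x ^+ 2 / 2 * (n ^+ 5 / 2) <= F x ^+ 2 / 2 * \int[mu]_(y in D) K (x - y).
  by rewrite ler_wpM2l// divr_ge0// sqr_ge0.
have h2 : c / 2 * \int[mu]_(y in D) lorentz n (y - x) <= c / 2 * (4 / n).
  by rewrite ler_wpM2l// divr_ge0.
have h3 : c / 2 * (4 / n) = 2 * 50 ^+ 3 * n ^+ 4 * H x.
  by rewrite /c; field; rewrite gt_eqF.
rewrite h3 in h2.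
apply: le_trans (lerB h1 h2); rewrite le_eqVlt; apply/orP; left; apply/eqP.
by field.
Qed.

Lemma quadratic_form_energy :
  mu.-integrable D (EFin \o (fun x => F x * \int[mu]_(y in D) (F y * K (x - y)))) ->
  (forall x, mu.-integrable D (EFin \o (fun y => F y * K (x - y)))) ->
  n ^+ 5 / 4 * \int[mu]_(x in D) (F x ^+ 2)
    - 8 * 50 ^+ 3 * n ^+ 3 * \int[mu]_(x in I11) (U x ^+ 2) <=
  \int[mu]_(x in D) (F x * \int[mu]_(y in D) (F y * K (x - y))).
Proof.
move=> iT iFK.
have [iH Hle] := lorentz_average_energy n0 mD DI (fun t => sqr_ge0 (U t)) iU2.
rewrite -/H in iH Hle.
apply: (@le_trans _ _ (\int[mu]_(x in D)
   (n ^+ 5 / 4 * F x ^+ 2 - 2 * 50 ^+ 3 * n ^+ 4 * H x))); last first.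
  apply: le_Rintegral => //.
  - by apply: integrable_sub => //; exact: integrable_scale.
  - by move=> x Dx; exact: pointwise_energy.
rewrite RintegralB//; [|exact: integrable_scale..].
rewrite !RintegralZl//.
rewrite lerD2l lerN2.
set h := \int[mu]_(x in D) _ in Hle *.
set u := \int[mu]_(x in I11) _ in Hle *.
have -> : 8 * 50 ^+ 3 * n ^+ 3 * u = 2 * 50 ^+ 3 * n ^+ 4 * (4 / n * u).
  by field; rewrite gt_eqF.
by rewrite ler_wpM2l// !mulr_ge0// exprn_ge0// ltW.
Qed.

End FixedFrequency.

(** Modulating the kernel by cos (eta t) shifts its frequencies to w + eta and
w - eta, and it remains between Q / 2 and Q because |eta t| <= 1 on [-2, 2].
Averaging over eta gives the integral of the power spectrum over [-1, 1]. *)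
Lemma energy_le_fourier_power : W <= 2^-1 ->
  n ^+ 5 / 4 * \int[mu]_(x in D) (F x ^+ 2)
    - 8 * 50 ^+ 3 * n ^+ 3 * \int[mu]_(x in I11) (U x ^+ 2) <=
  M * \int[mu]_(w in I11) fourier_power D F w.
Proof.
move=> W2; have [s [QE sW sM]] := QM.
set E := _ - _; set P := fourier_power D F.
have P0 w : 0 <= P w by exact: fourier_power_ge0.
have cP : continuous P by exact: fourier_power_continuous.
pose J : set R := `[- 2^-1, 2^-1]%classic.
have mJ : measurable J by exact: measurable_itv.
have muJ : mu J = 1%E.
  rewrite /J lebesgue_measure_itv/= lte_fin ifT; last by lra.
  by rewrite -EFinD; congr EFin; lra.
have ET eta : J eta -> E <= \sum_(p <- s) `|p.1| / 2 * (P (eta + p.2) + P (eta + - p.2)).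
  rewrite /J/= in_itv/= -ler_norml => eta2.
  (* The cosine sum Q (t) cos (eta t), by the addition formula. *)
  pose s' := [seq (p.1 / 2, p.2 + eta) | p <- s] ++ [seq (p.1 / 2, p.2 - eta) | p <- s].
  have KE : (fun t => \sum_(p <- s') p.1 * cos (p.2 * t)) = (fun t => Q t * cos (eta * t)).
    apply/funext => t; rewrite QE big_cat/= !big_map/= -big_split/= mulr_suml.
    by apply: eq_bigr => p _; rewrite mulrDl mulrBl cosD cosB; field.
  have := quadratic_form_cosine_sum mD iF s'; rewrite KE => -[iT TE].
  have := quadratic_form_energy eta2 iT; rewrite -/E => /(_ _)/le_trans; apply.
    move=> x; have [ix _] := convolution_cosine_sum mD iF s' x.
    apply: eq_integrable ix => // y _ /=; congr (F y * _)%:E.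
    exact: (congr1 (fun f => f (x - y)) KE).
  rewrite TE big_cat/= !big_map/= -big_split/=; apply: ler_sum => p _.
  rewrite -/P -[P (p.2 - eta)]fourier_powerN// opprB [p.2 + eta]addrC -mulrDr.
  by apply: ler_wpM2r; [exact: addr_ge0|rewrite ler_pM2r// ler_norm].
pose G eta := \sum_(p <- s) `|p.1| / 2 * (P (eta + p.2) + P (eta + - p.2)).
have sW2 p : p \in s -> `|p.2| <= 2^-1 by move=> /sW/le_trans; apply.
have [iG Gle] := Rintegral_sum_translates_le cP P0 sW2.
rewrite -/G -/J in iG Gle.
have : E <= \int[mu]_(eta in J) G eta.
  have -> : E = \int[mu]_(eta in J) E by rewrite Rintegral_cst// [X in fine X]muJ mulr1.
  apply: le_Rintegral => //.
  by apply: (@integrable_bounded _ _ _ `|E|) => //; rewrite [X in (X < _)%E]muJ ltry.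
move=> /le_trans; apply; apply: le_trans Gle _.
by rewrite ler_wpM2r// Rintegral_ge0.
Qed.

End KernelEnergy.

(** * Balancing the kernel cost, and norms *)

Section PowerBalance.
Context {R : realType}.

Lemma powR_opp_self_le (x : R) : 0 <= x -> x `^ (- x) <= expR 1.
Proof.
rewrite le_eqVlt => /predU1P[<-|x0].
  by rewrite oppr0 powRr0 -expR0 ler_expR.
rewrite /powR gt_eqF// ler_expR.
have := ln_sublinear (_ : 0 < x^-1); rewrite invr_gt0 => /(_ x0)/ltW.
by rewrite lnV// -(ler_pM2l x0) divff ?gt_eqF// mulrN mulNr.
Qed.

(** The number N is the first integer above C r.  For C r <= 1 it is at most 2 and
x^(-x) <= e takes care of the power; for C r > 1 one has N <= 2 C r, and with
y = 60 C r the cost is at most y^(24 C r) <= y^y. *)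
Lemma kernel_cost_balance (C r : R) : 0 < C -> 0 <= r ->
  exists N : nat, [/\ (0 < N)%N, C * r <= N%:R &
    (60 * C * r) `^ (- (60 * C * r)) * (30 * N%:R) ^+ (12 * N) <= expR 1 * 60 ^+ 24].
Proof.
move=> C0 r0; have Cr0 : 0 <= C * r by rewrite mulr_ge0// ltW.
exists (Num.truncn (C * r)).+1; split => //.
  by have /andP[_ /ltW] := truncn_itv Cr0.
have /andP[Nle _] := truncn_itv Cr0.
set N := (Num.truncn (C * r)).+1.
have N1 : N%:R <= C * r + 1 by rewrite /N -natr1 lerD2r.
have e1 : 1 <= expR 1 :> R by rewrite -expR0 ler_expR.
have e60 : 0 < expR 1 * 60 ^+ 24 :> R by rewrite mulr_gt0 ?expR_gt0// exprn_gt0.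
rewrite -mulrA; set y := 60 * (C * r).
have y0 : 0 <= y by rewrite mulr_ge0.
have [Cr1|Cr1] := leP (C * r) 1.
  have N2 : (N <= 2)%N by rewrite -(ler_nat R); lra.
  apply: ler_pM => //; [exact: powR_ge0|exact: powR_opp_self_le|].
  apply: (@le_trans _ _ (60 ^+ (12 * N))).
    by rewrite lerXn2r ?nnegrE//; lra.
  by rewrite ler_eXn2l; [lia|lra].
apply: (@le_trans _ _ 1); last first.
  by rewrite -[leLHS]mulr1 ler_pM// exprn_ege1//; lra.
have y1 : 1 <= y by rewrite /y; lra.
have yy : 0 < y `^ y by rewrite powR_gt0; lra.
rewrite powRN mulrC ler_pdivrMr// mul1r.
apply: (@le_trans _ _ (y ^+ (12 * N))).
  by rewrite lerXn2r ?nnegrE//; rewrite /y; lra.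
rewrite -powR_mulrn//; apply: ler_powR => //.
by rewrite natrM /y; lra.
Qed.

End PowerBalance.

Section SobolevRepresentatives.
Context {R : realType}.
Notation mu := (@lebesgue_measure R).

Lemma L2_integrable (f : R -> R) : L2 f ->
  mu.-integrable I11 (EFin \o f) /\ mu.-integrable I11 (EFin \o (fun x => f x ^+ 2)).
Proof.
move=> f2; have mI := @measurable_I11 R.
have /integrableS : mu.-integrable setT (EFin \o (fun x => (f \_ I11) x ^+ 2)).
  exact: Lfun2_integrable_sqr.
move=> /(_ I11 measurableT mI (@subsetT _ _)) i2.
have {}i2 : mu.-integrable I11 (EFin \o (fun x => f x ^+ 2)).
  by apply: eq_integrable i2 => // x xI /=; rewrite patchE xI.
split=> //.
have mf : measurable_fun I11 f.
  move: f2; rewrite /L2 inE => /andP[+ _]; rewrite inE/= => mf.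
  by apply/(measurable_restrictT _ mI).
apply: (@le_integrable _ _ _ mu _ mI _ (EFin \o (fun x => 1 + f x ^+ 2))).
- exact/measurable_EFinP.
- move=> x _; rewrite /= lee_fin.
  rewrite [leRHS]ger0_norm; last by rewrite addr_ge0// sqr_ge0.
  by rewrite -(real_normK (num_real (f x))); have := normr_ge0 (f x); nra.
- apply: integrable_add => //; apply: (@integrable_bounded _ _ _ 1) => //.
    by rewrite mu_I11 ltry.
  by move=> x _; rewrite normr1.
Qed.

Lemma L2norm_sqr (f : R -> R) : L2 f ->
  0 <= L2norm f /\ L2norm f ^+ 2 = \int[mu]_(x in I11) (f x ^+ 2).
Proof.
move=> f2; split; first by rewrite fine_ge0// Lnorm_ge0.
have mI := @measurable_I11 R.
have E : (Lnorm leb 2%:E (EFin \o (f \_ I11)) `^ 2 = \int[mu]_(x in I11) (f x ^+ 2)%:E)%E.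
  rewrite poweR_Lnorm// [RHS]integral_mkcond; apply: eq_integral => x _.
  rewrite /= !patchE; case: ifP => _; rewrite powR_mulrn// ?real_normK ?num_real//.
  by rewrite expr0n.
have Nfin : Lnorm leb 2%:E (EFin \o (f \_ I11)) \is a fin_num.
  rewrite ge0_fin_numE ?Lnorm_ge0//.
  by move: f2; rewrite /L2 inE => /andP[_]; rewrite inE.
rewrite /L2norm /Rintegral -E -(fineK Nfin) poweR_EFin/= powR_mulrn//.
by rewrite fine_ge0// Lnorm_ge0.
Qed.

Lemma cmod_fourier_sqr (f : R -> R) (w : R) :
  cmod (fourier f w) ^+ 2 = fourier_power I11 f w.
Proof.
rewrite /cmod /fourier /cintegral /=.
rewrite sqr_sqrtr; last by rewrite addr_ge0// sqr_ge0.
rewrite /fourier_power /fourier_cos /fourier_sin; congr (_ ^+ 2 + _ ^+ 2);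
  by apply: eq_Rintegral => x _ /=; rewrite mul0r ?subr0 ?addr0.
Qed.

End SobolevRepresentatives.

(** * The lower bound *)

Section Sobolev.
Context {R : realType}.
Notation mu := (@lebesgue_measure R).

(** The null set Z contains the points where f is not well represented by its
averages, together with the two endpoints; outside of it the increments of f are
controlled by its weak derivative. *)
Lemma sobolev_energy_le (f fx : R -> R) (N : nat) : L2 f -> H1_derivative f fx ->
  (0 < N)%N ->
  N%:R ^+ 5 / 4 * \int[mu]_(x in I11) (f x ^+ 2)
    - 8 * 50 ^+ 3 * N%:R ^+ 3 * \int[mu]_(x in I11) (fx x ^+ 2) <=
  (30 * N%:R) ^+ (12 * N) * \int[mu]_(w in I11) fourier_power I11 f w.
Proof.
move=> f2 [fx2 ffx] N0; have mI := @measurable_I11 R.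
have [jf jf2] := L2_integrable f2; have [jfx jfx2] := L2_integrable fx2.
have [Z0 [mZ0 muZ0 lebZ0]] : {ae mu, forall x, lebesgue_pt (f \_ I11) x}.
  by apply: lebesgue_differentiation; exact: integrable_locally_restrict.
pose Z := Z0 `|` [set -1] `|` [set 1].
have mZ : measurable Z by apply: measurableU => //; exact: measurableU.
have muZ : mu Z = 0%E.
  apply: null_set_setU => //; [exact: measurableU| |exact: lebesgue_measure_set1].
  by apply: null_set_setU => //; exact: lebesgue_measure_set1.
pose D : set R := I11 `\` Z.
have mD : measurable D by exact: measurableD.
have DI : D `<=` I11 by exact: subIsetl.
have Dpt x : D x -> -1 < x < 1 /\ lebesgue_pt (f \_ I11) x.
  move=> [Ix /not_orP[/not_orP[Zx x1] x2]]; split; last first.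
    by apply: contrapT => nx; apply: Zx; exact: lebZ0.
  move: Ix; rewrite /I11/= in_itv/= !lt_neqAle => /andP[-> ->]; rewrite !andbT.
  by apply/andP; split; apply/eqP => xE; [apply: x1|apply: x2].
have toD (g : R -> R) : mu.-integrable I11 (EFin \o g) ->
    \int[mu]_(x in I11) g x = \int[mu]_(x in D) g x.
  by move=> ig; rewrite /Rintegral (negligible_integral mZ mI ig muZ).
have onD (g : R -> R) : mu.-integrable I11 (EFin \o g) -> mu.-integrable D (EFin \o g).
  by move=> ig; apply: integrableS ig.
have PD : fourier_power I11 f = fourier_power D f.
  apply/funext => w; rewrite /fourier_power /fourier_cos /fourier_sin.
  rewrite (toD (fun y => f y * cos (w * y))); last exact: integrable_mul_cos.
  by rewrite (toD (fun y => f y * sin (w * y)))//; exact: integrable_mul_sin.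
have [Q [QM Qle Qge]] := @concentrated_kernel R N N0.
rewrite PD (toD (fun x => f x ^+ 2))//.
apply: (energy_le_fourier_power mZ muZ (erefl D) (onD _ jf) (onD _ jf2) jfx jfx2 _ N0 QM Qle Qge) => //.
move=> x y /Dpt[x1 xl] /Dpt[y1 yl].
exact: weak_derivative_increment.
Qed.

End Sobolev.

Theorem theorem3 (R : realType) :
  exists c1 c2 : R, [/\ 0 < c1, 0 < c2 &
    forall f fx : R -> R,
      H1 f -> H1_derivative f fx ->
      ~ (f = cst 0 %[ae leb in I11]) ->
      c1 * (c2 * (L2norm fx / L2norm f)) `^ (- (c2 * (L2norm fx / L2norm f)))
         * \int[leb]_(x in I11) (`|f x| ^+ 2)
      <= \int[leb]_(xi in I11) (cmod (fourier f xi) ^+ 2)].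
Proof.
(* C^2 must dominate 8 * (8 * 50^3), the ratio of the two constants of the energy
   inequality when half of the main term is kept. *)
pose C : R := 3 * 10 ^+ 3.
have C0 : 0 < C by rewrite mulr_gt0// exprn_gt0.
pose e : R := expR 1 * 60 ^+ 24.
have e0 : 0 < e by rewrite mulr_gt0 ?expR_gt0// exprn_gt0.
exists (8 * e)^-1, (60 * C); split; [by rewrite invr_gt0 mulr_gt0|by rewrite mulr_gt0|].
move=> f fx [f2 _] Hfx _; have [fx2 _] := Hfx.
have -> : \int[leb]_(xi in I11) (cmod (fourier f xi) ^+ 2) =
    \int[lebesgue_measure]_(w in I11) fourier_power I11 f w.
  by apply: eq_Rintegral => w _; exact: cmod_fourier_sqr.
have -> : \int[leb]_(x in I11) (`|f x| ^+ 2) = \int[lebesgue_measure]_(x in I11) (f x ^+ 2).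
  by apply: eq_Rintegral => x _; rewrite real_normK ?num_real.
have [a0 aE] := L2norm_sqr f2; have [b0 bE] := L2norm_sqr fx2.
set a := L2norm f in a0 aE *; set b := L2norm fx in b0 bE *.
rewrite -aE; set P := Rintegral _ _ _.
have P0 : 0 <= P by apply: Rintegral_ge0 => w _; exact: fourier_power_ge0.
move: a0; rewrite le_eqVlt => /predU1P[<-|a0]; first by rewrite expr0n mulr0.
set r := b / a.
have r0 : 0 <= r by rewrite divr_ge0// ltW.
have [N [N0 rN cost]] := kernel_cost_balance C0 r0.
have := sobolev_energy_le f2 Hfx N0; rewrite -aE -bE -/P.
have bar : b = r * a by rewrite /r divfK// gt_eqF.
have n1 : 1 <= N%:R :> R by rewrite ler1n.
set n : R := N%:R in n1 rN cost *.
set M := (30 * n) ^+ (12 * N) in cost *.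
rewrite -/e in cost => energy.
have n2 : 8 * (8 * 50 ^+ 3) * r ^+ 2 <= n ^+ 2.
  have : (C * r) ^+ 2 <= n ^+ 2.
    by rewrite lerXn2r ?nnegrE ?ler0n// mulr_ge0// ltW.
  have C2 : 8 * (8 * 50 ^+ 3) <= C ^+ 2 by rewrite /C; lra.
  by rewrite exprMn; apply: le_trans; apply: ler_wpM2r C2; exact: sqr_ge0.
have h : a ^+ 2 / 8 <= M * P.
  apply: le_trans energy; rewrite bar.
  have n5 : a ^+ 2 <= n ^+ 5 * a ^+ 2 by rewrite ler_peMl ?sqr_ge0// exprn_ege1.
  have k0 : 0 <= n ^+ 3 * a ^+ 2 / 8.
    by rewrite divr_ge0// mulr_ge0 ?sqr_ge0// exprn_ge0// ler0n.
  have := ler_wpM2l k0 n2.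
  rewrite (_ : n ^+ 3 * a ^+ 2 / 8 * (8 * (8 * 50 ^+ 3) * r ^+ 2) =
    8 * 50 ^+ 3 * n ^+ 3 * (r * a) ^+ 2); last by field.
  rewrite (_ : n ^+ 3 * a ^+ 2 / 8 * n ^+ 2 = n ^+ 5 * a ^+ 2 / 8); last by field.
  by set A := a ^+ 2 in n5 *; set X := 8 * _ * _ * _; lra.
rewrite -/r in cost *; set p := _ `^ _ in cost *.
have p0 : 0 <= p by exact: powR_ge0.
rewrite -mulrA mulrC ler_pdivrMr ?mulr_gt0//.
apply: (@le_trans _ _ (p * (8 * (M * P)))).
  by rewrite ler_wpM2l//; lra.
rewrite (_ : p * _ = 8 * (p * M) * P); last by ring.
by rewrite [leRHS]mulrC ler_wpM2r// ler_wpM2l.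
Qed.
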